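(* There exist universal constants $C, C_1, C_2 > 0$ such that the following holds. Let $(x,y) \in \mathbb{R}^p \times \mathbb{R}$ be a joint random pair such that $y$ is sub-exponential and $x$ is isotropic and sub-exponential with $\|x\|_{\psi_1} \le \kappa$ for some $\kappa > 0$. Let $K \subset \mathbb{R}^p$ be a convex polytope with $D$ vertices and Euclidean diameter $\Delta_2(K)$, and let $\beta^* \in K$ be an expected risk minimizer on $K$, i.e., a solution to $$\min_{\beta \in K} \ \mathbb{E}\big[(y - \langle x, \beta\rangle)^2\big].$$ Let $(x_1,y_1), \dots, (x_n,y_n)$ be independent copies of $(x,y)$. Then for every $u \ge 8$, the following holds true with probability at least $1 - 5\exp(-C u^2) - 2\exp(-C\sqrt{n})$: If $$n \ge C_1 \cdot \Big(\kappa^{10} \cdot \Delta_2(K) \cdot \Big(\tfrac{\log(D)}{\sqrt{n}} + \sqrt{\log(D)}\Big) + \kappa^6 \cdot u\Big)^2,$$ then every minimizer $\hat\beta$ of $$\min_{\beta \in K} \ \tfrac{1}{n}\sum_{i=1}^n (y_i - \langle x_i, \beta\rangle)^2$$ satisfies $$\|\hat\beta - \beta^*\|_2 \le C_2 \cdot \kappa^{18} \cdot \max\{1, u^2 \cdot \sigma(\beta^* )\} \cdot \frac{\sqrt{\kappa \cdot \Delta_2(K) \cdot \log(D)}}{n^{1/4}},$$ where $\sigma(\beta^* ) := \|y - \langle x, \beta^*\rangle\|_{\psi_1}$.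
   Context: For a real-valued random variable $Z$, $\|Z\|_{\psi_1} := \inf\{t > 0 : \mathbb{E}[\exp(|Z|/t)] \le 2\}$; $Z$ is sub-exponential if $\|Z\|_{\psi_1} < \infty$. For a random vector $x \in \mathbb{R}^p$, $\|x\|_{\psi_1} := \sup_{v \in \mathbb{R}^p, \|v\|_2 = 1} \|\langle x, v\rangle\|_{\psi_1}$, and $x$ is (uniformly) sub-exponential if $\|x\|_{\psi_1} < \infty$. A random vector $x$ in $\mathbb{R}^p$ is isotropic if $\mathbb{E}[x x^T] = I_p$. A constant is universal if its value does not depend on any other involved parameter. Measure-theoretic issues (measurability of suprema, etc.) are disregarded. *)

(* Defs.v *)
From mathcomp Require Import all_boot all_order all_algebra.
From mathcomp Require Import all_classical all_reals all_analysis.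

Set Implicit Arguments.
Unset Strict Implicit.
Unset Printing Implicit Defensive.

Import Order.TTheory GRing.Theory Num.Theory.
Import numFieldNormedType.Exports.

Local Open Scope classical_set_scope.
Local Open Scope ring_scope.

Section Euclidean.
Context {R : realType} {p : nat}.
Implicit Types (u v : 'rV[R]_p) (K : set 'rV[R]_p).

Definition dotv u v : R := \sum_(j < p) u ord0 j * v ord0 j.

(* The library norm on ['rV[R]_p] is the sup norm. *)
Definition l2norm v : R := Num.sqrt (dotv v v).

(* Meaningful for nonempty bounded [K], the real [sup] being 0 otherwise. *)
Definition diam2 K : R := sup [set l2norm (b.1 - b.2) | b in K `*` K].

Definition convex_hull (S : set 'rV[R]_p) : set 'rV[R]_p :=
  smallest (fun A : set (convex_lmodType 'rV[R]_p) => convex_set A) S.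

Definition convex_polytope K : Prop :=
  exists2 S : set 'rV[R]_p, finite_set S & K = convex_hull S.

(* The vertices of a polytope are its extreme points. *)
Definition vertices K : set 'rV[R]_p :=
  [set v | K v /\ forall (a b : 'rV[R]_p) (t : R), K a -> K b -> 0 < t < 1 ->
     v = t *: a + (1 - t) *: b -> a = b].

End Euclidean.

Definition minimizer_on {d : Order.disp_t} {O : porderType d} {T : Type}
    (K : set T) (f : T -> O) (b : T) : Prop :=
  K b /\ forall b' : T, K b' -> (f b <= f b')%O.

(* R^p with its Borel sigma-algebra. *)
Definition Rvec (R : realType) (p : nat) :=
  g_sigma_algebraType (@open 'rV[R]_p).

Section Psi1.
Context {d : measure_display} {T : measurableType d} {R : realType}.
Variable P : probability T R.
Local Open Scope ereal_scope.

(* Equal to +oo when no [t] is admissible. *)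
Definition psi1_norm (Z : T -> R) : \bar R :=
  ereal_inf [set t%:E | t in
    [set t : R | (0 < t)%R /\ 'E_P[fun w => expR (`|Z w| / t)%R] <= 2%:E]].

Definition psi1_norm_vec {p : nat} (x : T -> Rvec R p) : \bar R :=
  ereal_sup [set psi1_norm (fun w => dotv (x w) v) | v in
    [set v : 'rV[R]_p | l2norm v = 1%R]].

Definition isotropic {p : nat} (x : T -> Rvec R p) : Prop :=
  forall j k : 'I_p,
    'E_P[fun w => ((x w : 'rV[R]_p) ord0 j * (x w : 'rV[R]_p) ord0 k)%R] =
      ((1%:M : 'M[R]_p) j k)%:E.

(* Inner probability: [Q] itself is not required to be measurable. *)
Definition holds_with_prob_ge (r : R) (Q : set T) : Prop :=
  exists E : set T, [/\ measurable E, E `<=` Q & r%:E <= P E].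

End Psi1.

(* The population variable [z] may live on a different probability space. *)
Definition independent_copies {d0 d ds : measure_display}
    {T0 : measurableType d0} {T : measurableType d} {S : measurableType ds}
    {R : realType} (P0 : probability T0 R) (P : probability T R)
    (z : {RV P0 >-> S}) (n : nat) (Z : 'I_n -> {RV P >-> S}) : Prop :=
  (forall (i : 'I_n) (A : set S), measurable A ->
     distribution P (Z i) A = distribution P0 z A) /\
  (forall (J : {set 'I_n}) (A : 'I_n -> set S), (forall i, measurable (A i)) ->
     P (\bigcap_(i in [set` J]) (Z i @^-1` A i)) =
       (\prod_(i in J) P (Z i @^-1` A i))%E).

Section Risk.
Context {R : realType} {p : nat}.

Definition residual (z : Rvec R p * R) (b : 'rV[R]_p) : R :=
  z.2 - dotv z.1 b.

Definition risk {d : measure_display} {T : measurableType d}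
    (P : probability T R) (z : T -> Rvec R p * R) (b : 'rV[R]_p) : \bar R :=
  'E_P[fun w => residual (z w) b ^+ 2].

Definition empirical_risk {n : nat} (z : 'I_n -> Rvec R p * R)
    (b : 'rV[R]_p) : R :=
  n%:R^-1 * \sum_(i < n) residual (z i) b ^+ 2.

End Risk.

(* Main.v *)
Require Import Defs.
From mathcomp Require Import all_boot all_order all_algebra.
From mathcomp Require Import all_classical all_reals all_analysis.
From mathcomp Require Import finmap measurable_realfun.
From mathcomp Require Import ring lra.

(** Write [xi = y - <x, betastar>] and [h = betahat - betastar].  Optimality of
    [betahat] gives [mean <x_i, h>^2 <= 2 mean xi_i <x_i, h>], and convexity
    allows shrinking [h] to the target radius [r].

    The right-hand side is linear in [h], hence bounded by its values at the
    vertices, where [E xi <x, v - betastar> <= 0].  Truncating [xi] at a multiple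
    of [sigma sqrt n] makes the products sub-exponential, so that Chernoff's
    inequality at the single point [lambda ~ 1 / (sigma kappa Delta sqrt n)]
    survives a union bound over the vertices.

    For the left-hand side, the clipped square [phi t = min (t^2, tau^2)]
    satisfies [phi (s + t) <= 2 phi s + 2 phi t].  Maurey's sampling replaces [h]
    by an average [g] of [k ~ (kappa Delta / r)^2] vertices: the lower bound for
    [mean phi <x_i, g>] is uniform over the [D^k] possible [g], and
    [mean phi <x_i, g - h>] is controlled by the Huber-type averages
    [mean min (w^2, k tau |w|)], [w = <x_i, v - betastar>], at the vertices. *)

Set Implicit Arguments.
Unset Strict Implicit.
Unset Printing Implicit Defensive.

Import Order.TTheory GRing.Theory Num.Theory.
Import numFieldNormedType.Exports.

Local Open Scope classical_set_scope.
Local Open Scope ring_scope.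

(** Squares and products of sub-exponential variables need not have any exponential moment; this
    obstacle forces the truncation and the clipping. The order of [k] is a compromise: the sampling
    error [kappa^2 Delta^2 / k] must be small against [r^2], while the [D^k] averages cost [k log D]
    in a union bound whose exponent is of order [n r^2 / tau^2]. The fourth-moment condition for the
    clipped square imposes [tau] of order [kappa^2 r], so the exponent is of order [n / kappa^4],
    and [kappa^6 Delta^2 log D] has to be at most of order [n r^2]. As [r^2 sqrt n] is proportional
    to [Delta log D], this means that [sqrt n] dominates [Delta] up to powers of [kappa], which the
    assumed lower bound on [n] provides. In the probability, [u] enters only through the deviation
    level [u^2 log D] of the multiplier sums. As soon as [K] has two points, isotropy forces
    [kappa >= 1/4], so surplus powers of [kappa] only cost constants. *)

Section Dot.
Context {R : realType} {p : nat}.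
Implicit Types (u v w : 'rV[R]_p).

Lemma dotvC u v : dotv u v = dotv v u.
Proof. by apply: eq_bigr => j _; rewrite mulrC. Qed.

Lemma dotvDr u v w : dotv u (v + w) = dotv u v + dotv u w.
Proof. by rewrite -big_split; apply: eq_bigr => j _; rewrite mxE mulrDr. Qed.

Lemma dotvZr u a v : dotv u (a *: v) = a * dotv u v.
Proof. by rewrite mulr_sumr; apply: eq_bigr => j _; rewrite mxE mulrCA. Qed.

Lemma dotv0r u : dotv u 0 = 0.
Proof. by apply: big1 => j _; rewrite mxE mulr0. Qed.

Lemma dotvNr u v : dotv u (- v) = - dotv u v.
Proof. by rewrite -scaleN1r dotvZr mulN1r. Qed.

Lemma dotvBr u v w : dotv u (v - w) = dotv u v - dotv u w.
Proof. by rewrite dotvDr dotvNr. Qed.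

Lemma dotv_sumr (I : Type) (r : seq I) (F : I -> 'rV[R]_p) u :
  dotv u (\sum_(i <- r) F i) = \sum_(i <- r) dotv u (F i).
Proof. by elim/big_rec2: _ => [|i y x _ <-]; rewrite ?dotv0r ?dotvDr. Qed.

Lemma dotvv_ge0 v : 0 <= dotv v v.
Proof. by apply: sumr_ge0 => j _; rewrite -expr2 sqr_ge0. Qed.

Lemma dotvvE v : dotv v v = \sum_(j < p) v ord0 j ^+ 2.
Proof. by apply: eq_bigr => j _; rewrite expr2. Qed.

Lemma dotvvD u v : dotv (u + v) (u + v) = dotv u u + 2 * dotv u v + dotv v v.
Proof. by rewrite dotvDr !(dotvC (u + v)) !dotvDr (dotvC v u); ring. Qed.

Lemma dotvvB u v : dotv (u - v) (u - v) = dotv u u - 2 * dotv u v + dotv v v.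
Proof. by rewrite dotvvD !dotvNr (dotvC (- v) v) dotvNr opprK mulrN. Qed.

Lemma dotvvD_le u v : dotv (u + v) (u + v) <= 2 * dotv u u + 2 * dotv v v.
Proof. have := dotvv_ge0 (u - v); rewrite dotvvB dotvvD; lra. Qed.

Lemma dotvvZ a v : dotv (a *: v) (a *: v) = a ^+ 2 * dotv v v.
Proof. by rewrite dotvZr dotvC dotvZr; ring. Qed.

Lemma l2norm_ge0 v : 0 <= l2norm v.
Proof. exact: sqrtr_ge0. Qed.

Lemma sqr_l2norm v : l2norm v ^+ 2 = dotv v v.
Proof. by rewrite sqr_sqrtr ?dotvv_ge0. Qed.

Lemma dotvv_eq0 v : dotv v v = 0 -> v = 0.
Proof.
rewrite dotvvE => /eqP; rewrite psumr_eq0 => [/allP v0|j _]; last exact: sqr_ge0.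
apply/rowP => j; rewrite mxE; have := v0 j (mem_index_enum j).
by rewrite /= sqrf_eq0 => /eqP.
Qed.

Lemma l2normZ a v : 0 <= a -> l2norm (a *: v) = a * l2norm v.
Proof.
by move=> a0; rewrite /l2norm dotvvZ sqrtrM ?sqr_ge0// sqrtr_sqr ger0_norm.
Qed.

End Dot.

(** * Convex combinations, extreme points and the diameter of a polytope *)

Section Hull.
Context {R : realType} {p : nat}.
Implicit Types (v x : 'rV[R]_p) (K : set 'rV[R]_p) (s : seq 'rV[R]_p).

(** [convex_hull] is a smallest convex set and exhibits no weights; this is its explicit form for
    finitely many points. Attaching weights to points rather than positions makes the mixing of two
    combinations pointwise. *)
Definition hull s x := exists c : 'rV[R]_p -> R,
  [/\ forall a, 0 <= c a, \sum_(a <- s) c a = 1 & \sum_(a <- s) c a *: a = x].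

Lemma hull_mem s a : uniq s -> a \in s -> hull s a.
Proof.
move=> us sa; exists (fun b => (b == a)%:R); split=> [b|| ].
- by rewrite ler0n.
- rewrite (big_rem a)//= eqxx big_seq big1 ?addr0// => b.
  by rewrite mem_rem_uniq// !inE => /andP[/negbTE ->].
- rewrite (big_rem a)//= eqxx scale1r big_seq big1 ?addr0// => b.
  by rewrite mem_rem_uniq// !inE => /andP[/negbTE -> _]; rewrite scale0r.
Qed.

Lemma hull_conv s x y (t : R) : 0 <= t <= 1 -> hull s x -> hull s y ->
  hull s (t *: x + (1 - t) *: y).
Proof.
move=> /andP[t0 t1] [c [c0 c1 <-]] [d [d0 d1 <-]].
exists (fun a => t * c a + (1 - t) * d a); split=> [a||].
- by rewrite addr_ge0 ?mulr_ge0 ?subr_ge0.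
- by rewrite big_split/= -!mulr_sumr c1 d1; ring.
- by rewrite !scaler_sumr -big_split/=; apply: eq_bigr => a _;
    rewrite !scalerA -scalerDl.
Qed.

Lemma hull_rem s a x : uniq s -> a \in s -> hull (rem a s) a -> hull s x ->
  hull (rem a s) x.
Proof.
move=> us sa [d [d0 d1 da]] [c [c0 c1 cx]].
exists (fun b => c b + c a * d b); split=> [b||].
- by rewrite addr_ge0 ?mulr_ge0.
- by rewrite big_split/= -mulr_sumr d1 mulr1 addrC -c1 [RHS](big_rem a).
- rewrite -cx [RHS](big_rem a sa)/= addrC.
  under eq_bigr do rewrite scalerDl -scalerA.
  by rewrite big_split/= -scaler_sumr da.
Qed.

Definition convexK K := forall x y (t : R), 0 <= t <= 1 -> K x -> K y ->
  K (t *: x + (1 - t) *: y).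

Lemma convex_setP K : convexK K <->
  convex_set (K : set (convex_lmodType 'rV[R]_p)).
Proof.
split=> [cK x y l /set_mem Kx /set_mem Ky|cK x y t t01 Kx Ky].
- apply/mem_set; have := cK x y l%:num _ Kx Ky; apply.
  by rewrite ge0 le1.
- have [t0 t1] := andP t01; apply: set_mem.
  exact: (cK x y (Itv01 t0 t1) (mem_set Kx) (mem_set Ky)).
Qed.

Lemma convex_hull_sub (S : set 'rV[R]_p) K : convexK K -> S `<=` K ->
  convex_hull S `<=` K.
Proof. by move=> /convex_setP cK SK x; apply. Qed.

Lemma convexK_convex_hull (S : set 'rV[R]_p) : convexK (convex_hull S).
Proof.
by move=> x y t t01 Kx Ky A [cA SA]; apply: (proj2 (convex_setP _) cA) => //;
  [exact: Kx|exact: Ky].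
Qed.

(* A point of [s] that is not extreme is a combination of the other points
   of [s], so it can be dropped. *)
Lemma hull_vertices K s : convexK K -> uniq s -> (forall a, a \in s -> K a) ->
  (forall x, K x -> hull s x) ->
  exists s', [/\ uniq s', forall a, a \in s' -> vertices K a &
    forall x, K x -> hull s' x].
Proof.
move=> cK; have [m] := ubnP (size s); elim: m s => // m IH s sm us sK Ks.
have [sv|] := pselect (forall a, a \in s -> vertices K a); first by exists s.
move=> /existsNP[a0 /not_implyP[sa0 nv]].
have Ka0 : K a0 by exact: sK.
have [a [b [t [Ka Kb t01 a0E ab]]]] : exists a b t,
    [/\ K a, K b, 0 < t < 1, a0 = t *: a + (1 - t) *: b & a <> b].
  apply: contrapT => nex; apply: nv; split=> // a b t Ka Kb t01 E.
  by apply: contrapT => ab; apply: nex; exists a, b, t.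
have [c [c0 c1 ca]] := Ks _ Ka; have [d [d0 d1 db]] := Ks _ Kb.
have {t01}[t0 t1] := andP t01.
pose e x := t * c x + (1 - t) * d x.
have e0 x : 0 <= e x by rewrite addr_ge0 ?mulr_ge0 ?subr_ge0// ltW.
have e1 : \sum_(x <- s) e x = 1.
  by rewrite big_split/= -!mulr_sumr c1 d1; ring.
have ea0 : \sum_(x <- s) e x *: x = a0.
  rewrite a0E -ca -db !scaler_sumr -big_split/=; apply: eq_bigr => x _.
  by rewrite !scalerA -scalerDl.
have le1 (f : 'rV[R]_p -> R) : (forall x, 0 <= f x) -> \sum_(x <- s) f x = 1 ->
    f a0 <= 1.
  by move=> f0 <-; rewrite (big_rem a0)//= lerDl sumr_ge0.
(* Weight one at [a0] leaves none for the other points, so the combination is [a0] itself. *)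
have eq1 (f : 'rV[R]_p -> R) : (forall x, 0 <= f x) -> \sum_(x <- s) f x = 1 ->
    f a0 = 1 -> \sum_(x <- s) f x *: x = a0.
  move=> f0; rewrite (big_rem a0)//= => /[swap] fa0 ; rewrite fa0 => fs.
  have {}fs : \sum_(x <- rem a0 s) f x = 0 by lra.
  rewrite (big_rem a0)//= fa0 scale1r big_seq big1 ?addr0// => x sx.
  have /eqP := fs; rewrite psumr_eq0// => /allP/(_ _ sx)/eqP ->.
  by rewrite scale0r.
(* Otherwise [c a0] and [d a0], both at most one with a weighted mean of one, would equal one, and
   [a], [b] would coincide with [a0]. *)
have ea01 : e a0 < 1.
  rewrite lt_neqAle le1// andbT; apply/eqP => eq.
  have ca1 := le1 _ c0 c1; have da1 := le1 _ d0 d1.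
  have t2 : 0 < 1 - t by rewrite subr_gt0.
  have eq' : t * (1 - c a0) + (1 - t) * (1 - d a0) = 0.
    by rewrite -[RHS](subrr (e a0)) {1}eq /e; ring.
  have p1 : 0 <= t * (1 - c a0) by rewrite mulr_ge0 ?subr_ge0 // ltW.
  have p2 : 0 <= (1 - t) * (1 - d a0) by rewrite mulr_ge0 ?subr_ge0 // ltW.
  apply: ab; rewrite -ca -db !eq1//.
  - have /eqP : (1 - t) * (1 - d a0) = 0 by lra.
    by rewrite mulf_eq0 gt_eqF//= subr_eq0 eq_sym => /eqP.
  - have /eqP : t * (1 - c a0) = 0 by lra.
    by rewrite mulf_eq0 gt_eqF//= subr_eq0 eq_sym => /eqP.
have e2 : 0 < 1 - e a0 by rewrite subr_gt0.
(* [a0] has weight below one in its own representation; solving for it leaves a combination of the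
   other points. *)
have hr : hull (rem a0 s) a0.
  exists (fun x => e x / (1 - e a0)); split=> [x||].
  - by rewrite divr_ge0// ltW.
  - rewrite -mulr_suml; apply: (canLR (mulfK _)); rewrite ?gt_eqF//.
    by have := e1; rewrite (big_rem a0)//=; lra.
  - under eq_bigr do rewrite mulrC -scalerA.
    rewrite -scaler_sumr; apply: (canLR (scalerK _)).
      by rewrite gt_eqF.
    by rewrite scalerBl scale1r -{2}ea0 (big_rem a0 sa0)/= addrAC subrr add0r.
apply: (IH (rem a0 s)).
- rewrite size_rem//; have : (0 < size s)%N by case: (s) sa0.
  by move: sm; case: (size s).
- exact: rem_uniq.
- by move=> x /mem_rem; exact: sK.
- by move=> x Kx; apply: (hull_rem us sa0 hr); exact: Ks.
Qed.

Lemma polytope_hull K : convex_polytope K ->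
  exists s, [/\ uniq s, forall a, a \in s -> vertices K a &
    forall x, K x -> hull s x].
Proof.
move=> [S /finite_seqP[s ->] ->]; apply: (@hull_vertices _ (undup s)).
- exact: convexK_convex_hull.
- exact: undup_uniq.
- by move=> a; rewrite mem_undup => sa A [_]; apply.
- apply: convex_hull_sub => [x y t t01|a /= sa]; first exact: hull_conv.
  by apply: hull_mem; rewrite ?undup_uniq ?mem_undup.
Qed.

Lemma polytope_convex K : convex_polytope K -> convexK K.
Proof. by move=> [S _ ->]; exact: convexK_convex_hull. Qed.

Lemma uniq_vertices_size K (D : nat) s : (vertices K #= `I_D)%card ->
  uniq s -> (forall a, a \in s -> vertices K a) -> (size s <= D)%N.
Proof.
move=> VD us sV; rewrite -(card_fset_set VD).
apply: uniq_leq_size => // a sa.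
rewrite in_fset_set; first by apply/mem_set; exact: sV.
by apply/finite_setP; exists D.
Qed.

(** The weighted mean of the squared distances from [x] to the points is nonnegative, and it equals
    the weighted mean of their squared norms minus that of [x]. *)
Lemma hull_dotvv_le s x M : (forall a, a \in s -> dotv a a <= M) -> hull s x ->
  dotv x x <= M.
Proof.
move=> sM [c [c0 c1 cx]].
have : 0 <= \sum_(a <- s) c a * dotv (x - a) (x - a).
  by apply: sumr_ge0 => a _; rewrite mulr_ge0 ?dotvv_ge0.
have -> : \sum_(a <- s) c a * dotv (x - a) (x - a) =
    \sum_(a <- s) c a * dotv a a - dotv x x.
  have xx : dotv x x = \sum_(a <- s) c a * dotv x a.
    by rewrite -{2}cx dotv_sumr; apply: eq_bigr => a _; rewrite dotvZr.
  under eq_bigr do rewrite dotvvB mulrDr mulrBr mulrCA.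
  by rewrite big_split/= sumrB -mulr_suml c1 mul1r -mulr_sumr -xx; ring.
have : \sum_(a <- s) c a * dotv a a <= M.
  rewrite -[M]mul1r -c1 mulr_suml big_seq [leRHS]big_seq.
  by apply: ler_sum => a sa; rewrite ler_wpM2l// sM.
lra.
Qed.

(** [diam2] is a real [sup], so it bounds the distances only once these are known to be bounded; the
    finitely many vertices give the bound [M]. *)
Lemma l2norm_le_diam2 K x y : convex_polytope K -> K x -> K y ->
  l2norm (x - y) <= diam2 K.
Proof.
move=> /polytope_hull[s [_ _ Ks]] Kx Ky.
pose M := \sum_(a <- s) dotv a a.
have sM a : a \in s -> dotv a a <= M.
  by move=> sa; rewrite /M (big_rem a)//= lerDl sumr_ge0// => ? _; exact: dotvv_ge0.
have KM z : K z -> dotv z z <= M by move=> /Ks; exact: hull_dotvv_le.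
apply: ub_le_sup; last by exists (x, y).
exists (Num.sqrt (2 * M + 2 * M)) => _ [[a b] [/= Ka Kb] <-].
apply: ler_wsqrtr; apply: le_trans (dotvvD_le _ _) _.
rewrite dotvNr dotvC dotvNr opprK; have := KM _ Ka; have := KM _ Kb; lra.
Qed.

End Hull.

(** * Maurey sampling and clipped squares *)

Section Maurey.
Context {R : realType}.

Lemma exists_le_average (J : finType) (c F : J -> R) (B : R) :
  (forall j, 0 <= c j) -> \sum_j c j = 1 -> \sum_j c j * F j <= B ->
  exists j, F j <= B.
Proof.
move=> c0 c1 cF; apply: contrapT => nF.
have BF j : B < F j by rewrite ltNge; apply/negP => Fj; apply: nF; exists j.
have /eqP : \sum_j c j * (F j - B) = 0.
  apply/eqP; rewrite eq_le sumr_ge0 ?andbT => [|j _].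
    under eq_bigr do rewrite mulrBr.
    by rewrite sumrB -mulr_suml c1 mul1r subr_le0.
  by rewrite mulr_ge0// subr_ge0 ltW.
rewrite psumr_eq0 => [/allP cF0|j _]; last by rewrite mulr_ge0// subr_ge0 ltW.
have /eqP := c1; rewrite big1 => [|j _]; first by rewrite eq_sym oner_eq0.
have /= := cF0 j (mem_index_enum j); rewrite mulf_eq0 => /orP[/eqP//|].
by rewrite subr_eq0 gt_eqF.
Qed.

(* Derandomised Maurey sampling: each new sample is chosen so that the squared
   error grows by at most its conditional expectation. *)
Lemma maurey_greedy (J I : finType) (c : J -> R) (V : J -> I -> R) (k : nat) :
  (forall j, 0 <= c j) -> \sum_j c j = 1 ->
  exists t : k.-tuple J,
    \sum_i (\sum_(j <- t) V j i - k%:R * \sum_j c j * V j i) ^+ 2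
    <= k%:R * \sum_j c j * \sum_i V j i ^+ 2.
Proof.
move=> c0 c1; elim: k => [|k [t IH]].
  by exists [tuple]; rewrite mul0r big1// => i _; rewrite big_nil mul0r subr0 expr0n.
pose x i := \sum_j c j * V j i.
pose S i := \sum_(j <- t) V j i - k%:R * x i.
have [j Hj] : exists j, \sum_i (S i + (V j i - x i)) ^+ 2 <=
    \sum_i S i ^+ 2 + \sum_j c j * \sum_i V j i ^+ 2.
  apply: (@exists_le_average _ c) => //.
  under eq_bigr do rewrite mulr_sumr; rewrite exchange_big/=.
  under [X in _ <= _ + X]eq_bigr do rewrite mulr_sumr.
  rewrite [X in _ <= _ + X]exchange_big/= -big_split/=.
  apply: ler_sum => i _.
  (* Under the weights [c] the increment has mean zero, so the cross term vanishes; the inequality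
     comes from discarding [- x i ^+ 2]. *)
  have -> : \sum_j c j * (S i + (V j i - x i)) ^+ 2 =
      \sum_j (c j * V j i ^+ 2 + 2 * (S i - x i) * (c j * V j i)
             + c j * (S i - x i) ^+ 2) by apply: eq_bigr => j _; ring.
  rewrite !big_split/= -mulr_sumr -mulr_suml c1 -/(x i).
  by have := sqr_ge0 (x i); lra.
exists [tuple of j :: t]; rewrite -natr1 [leRHS]mulrDl mul1r.
apply: le_trans (lerD IH (lexx _)); apply: le_trans Hj.
rewrite le_eqVlt; apply/orP; left; apply/eqP; apply: eq_bigr => i _.
by congr (_ ^+ 2); rewrite big_cons /S /x; ring.
Qed.

Definition clipsq (tau z : R) : R := Num.min (z ^+ 2) (tau ^+ 2).

Lemma clipsq_le_sqr tau z : clipsq tau z <= z ^+ 2.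
Proof. by rewrite ge_min lexx. Qed.

Lemma clipsq_ge0 tau z : 0 <= clipsq tau z.
Proof. by rewrite le_min !sqr_ge0. Qed.

Lemma clipsqD_le tau a b :
  clipsq tau (a + b) <= 2 * clipsq tau a + 2 * clipsq tau b.
Proof.
have := clipsq_ge0 tau a; have := clipsq_ge0 tau b.
rewrite {1 2}/clipsq.
have sq : (a + b) ^+ 2 <= 2 * a ^+ 2 + 2 * b ^+ 2.
  by have := sqr_ge0 (a - b); lra.
have t0 := sqr_ge0 tau.
rewrite /clipsq; case: (leP (a ^+ 2)); case: (leP (b ^+ 2)) => *;
  rewrite ge_min; apply/orP; [left|right|right|right]; lra.
Qed.

(** If [|b| >= tau], the clipping level [tau^2] is already below [tau |b|]; otherwise
    [b^2 <= tau |b|]. A summand controlled only in the first power is thus admissible. *)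
Lemma clipsqD_le_sqr_abs tau a b : 0 <= tau ->
  clipsq tau (a + b) <= 2 * a ^+ 2 + 2 * tau * `|b|.
Proof.
move=> t0; rewrite /clipsq ge_min.
have a2 := sqr_ge0 a; have b0 := normr_ge0 b.
case: (leP tau `|b|) => tb; apply/orP; [right|left].
  by rewrite expr2; nra.
have : `|b| ^+ 2 <= tau * `|b| by rewrite expr2 ler_wpM2r// ltW.
by rewrite real_normK ?num_real//; have := sqr_ge0 (a - b); lra.
Qed.

(** Split each [W j i] at the level [k tau]. The bounded part is sampled in mean square, with an
    error of order [S / k]. The large part is kept in the first power: its total is at most
    [S / (k tau)] and clipping charges a factor [tau], which gives [S / k] again. This balance
    dictates the threshold [k tau]. *)
Lemma maurey_clipsq (p D k n : nat) (W : 'I_D -> 'I_n -> R)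
    (v : 'I_D -> 'rV[R]_p) (c : 'I_D -> R) (tau S A g : R) :
  (0 < k)%N -> 0 < tau -> 0 <= g ->
  (forall j, 0 <= c j) -> \sum_j c j = 1 ->
  (forall j, \sum_i Num.min (W j i ^+ 2) (k%:R * tau * `|W j i|) <= S) ->
  (forall j, dotv (v j) (v j) <= A) ->
  exists t : k.-tuple 'I_D,
    let e := k%:R^-1 *: \sum_(j <- t) v j - \sum_j c j *: v j in
    g * dotv e e <= (S + g * A) / k%:R /\
    \sum_i clipsq tau (k%:R^-1 * \sum_(j <- t) W j i - \sum_j c j * W j i)
      <= (6 * S + 2 * g * A) / k%:R.
Proof.
move=> k0 t0 g0 c0 c1 WS vA.
have k0' : 0 < k%:R :> R by rewrite ltr0n.
have kV : 0 <= k%:R^-1 :> R by rewrite invr_ge0 ltW.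
have kt0 : 0 < k%:R * tau by rewrite mulr_gt0.
pose Wb j i := if `|W j i| <= k%:R * tau then W j i else 0.
pose Wt j i := if `|W j i| <= k%:R * tau then 0 else W j i.
have WE j i : W j i = Wb j i + Wt j i.
  by rewrite /Wb /Wt; case: ifP; rewrite ?addr0 ?add0r.
have Wbt j i : Wb j i ^+ 2 <= Num.min (W j i ^+ 2) (k%:R * tau * `|W j i|) /\
    k%:R * tau * `|Wt j i| <= Num.min (W j i ^+ 2) (k%:R * tau * `|W j i|).
  rewrite /Wb /Wt !le_min; case: ifPn => [Wle|].
    rewrite normr0 mulr0 sqr_ge0 lexx/=.
    split; last by rewrite mulr_ge0// ltW.
    by rewrite -(real_normK (num_real _)) expr2 ler_wpM2r.
  rewrite -ltNge => Wgt; rewrite expr0n/= sqr_ge0 lexx andbT/=.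
  split; first by rewrite mulr_ge0// ltW.
  by rewrite -[leRHS](real_normK (num_real _)) expr2 ler_wpM2r// ltW.
(* Appending the coordinates of [v], weighted by [sqrt g], lets one and the same sample control both
   the empirical errors and the Euclidean error. *)
pose U j (i : 'I_n + 'I_p) := match i with
  | inl i => Wb j i | inr l => Num.sqrt g * v j ord0 l end.
have [t tU] := maurey_greedy U k c0 c1.
exists t => e.
pose Zb i := k%:R^-1 * (\sum_(j <- t) Wb j i) - \sum_j c j * Wb j i.
pose Zt i := k%:R^-1 * (\sum_(j <- t) Wt j i) - \sum_j c j * Wt j i.
have UA : \sum_j c j * (\sum_i U j i ^+ 2) <= S + g * A.
  rewrite -[leRHS]mul1r -[X in _ <= X * _]c1 mulr_suml; apply: ler_sum => j _.
  rewrite ler_wpM2l// big_sumType/=; apply: lerD.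
    by apply: le_trans (WS j); apply: ler_sum => i _; case: (Wbt j i).
  under eq_bigr do rewrite exprMn sqr_sqrtr//.
  by rewrite -mulr_sumr -dotvvE ler_wpM2l.
have main : (\sum_i Zb i ^+ 2) + g * dotv e e <= (S + g * A) / k%:R.
  rewrite ler_pdivlMr// -(ler_pM2l k0').
  apply: le_trans (le_trans tU (ler_wpM2l (ltW k0') UA)).
  rewrite big_sumType/= mulrDl mulrDr.
  rewrite le_eqVlt; apply/orP; left; apply/eqP; congr (_ + _).
    rewrite mulr_suml mulr_sumr; apply: eq_bigr => i _.
    by rewrite /Zb; field; lra.
  rewrite dotvvE mulr_sumr mulr_suml mulr_sumr; apply: eq_bigr => l _.
  rewrite /e !mxE !summxE.
  under [in RHS]eq_bigr do rewrite mulrC.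
  rewrite -mulr_suml.
  rewrite (_ : \sum_j c j * (Num.sqrt g * v j ord0 l) =
      Num.sqrt g * \sum_j (c j *: v j) ord0 l); last first.
    by rewrite mulr_sumr; apply: eq_bigr => j _; rewrite mxE; ring.
  rewrite -{1}(sqr_sqrtr g0); field; lra.
have dd0 := dotvv_ge0 e.
have Zb0 : 0 <= \sum_i Zb i ^+ 2 by apply: sumr_ge0 => i _; exact: sqr_ge0.
have gd0 : 0 <= g * dotv e e by rewrite mulr_ge0.
split; first by apply: le_trans main; rewrite lerDr.
have Wts j : \sum_i `|Wt j i| <= S / (k%:R * tau).
  rewrite ler_pdivlMr// mulrC mulr_sumr; apply: le_trans (WS j).
  by apply: ler_sum => i _; case: (Wbt j i).
have Zts : \sum_i `|Zt i| <= 2 * (S / (k%:R * tau)).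
  apply: (@le_trans _ _ (\sum_i (k%:R^-1 * (\sum_(j <- t) `|Wt j i|) +
      \sum_j c j * `|Wt j i|))).
    apply: ler_sum => i _; apply: le_trans (ler_normB _ _) _; apply: lerD.
      by rewrite normrM (ger0_norm kV) ler_wpM2l// ler_norm_sum.
    apply: le_trans (ler_norm_sum _ _ _) _; apply: ler_sum => j _.
    by rewrite normrM ger0_norm.
  rewrite big_split/= -mulr_sumr exchange_big/= [X in _ + X]exchange_big/=.
  rewrite mulrDl !mul1r; apply: lerD.
    rewrite mulrC ler_pdivrMr// [leRHS]mulrC.
    apply: (@le_trans _ _ (\sum_(j <- t) S / (k%:R * tau))); first exact: ler_sum.
    by rewrite big_const_seq count_predT size_tuple iter_addr_0 [leRHS]mulr_natl.
  rewrite -[leRHS]mul1r -[X in _ <= X * _]c1 mulr_suml; apply: ler_sum => j _.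
  by rewrite -mulr_sumr ler_wpM2l.
apply: (@le_trans _ _ (\sum_i (2 * Zb i ^+ 2 + 2 * tau * `|Zt i|))).
  apply: ler_sum => i _; rewrite (_ : _ - _ = Zb i + Zt i).
    by apply: clipsqD_le_sqr_abs; exact: ltW.
  under eq_bigr do rewrite WE; under [X in _ - X]eq_bigr do rewrite WE mulrDr.
  by rewrite !big_split/= /Zb /Zt; ring.
rewrite big_split/= -!mulr_sumr.
have : 2 * tau * \sum_i `|Zt i| <= 4 * S / k%:R.
  apply: (@le_trans _ _ (2 * tau * (2 * (S / (k%:R * tau))))).
    by rewrite ler_wpM2l// mulr_ge0// ltW.
  rewrite le_eqVlt; apply/orP; left; apply/eqP; field; lra.
rewrite !mulrDl in main *; lra.
Qed.

End Maurey.

Import HBNNSimple.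

(** * Expectation of a product of independent factors *)

Section ProductRule.
Local Open Scope ereal_scope.
Context {d ds : measure_display} {T : measurableType d} {S : measurableType ds}
  {R : realType}.
Variable P : probability T R.

(** In the intended use [Y] is the product of the other factors and [c] its mean. Linearity passes
    from indicators to simple functions, monotone convergence from these to [f]. *)
Lemma ge0_integralM_comp (Y : T -> R) (Z : T -> S) (c : R) (f : S -> \bar R) :
  measurable_fun [set: T] Y -> (forall w, (0 <= Y w)%R) ->
  measurable_fun [set: T] Z -> (0 <= c)%R ->
  (forall A : set S, measurable A ->
    \int[P]_w (Y w * \1_A (Z w))%:E = c%:E * \int[P]_w (\1_A (Z w))%:E) ->
  measurable_fun [set: S] f -> (forall z, 0 <= f z) ->
  \int[P]_w ((Y w)%:E * f (Z w)) = c%:E * \int[P]_w f (Z w).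
Proof.
move=> mY Y0 mZ c0 YA mf f0.
have mYE : measurable_fun [set: T] (EFin \o Y) by exact/measurable_EFinP.
have YE0 w : 0 <= (Y w)%:E by rewrite lee_fin.
pose g := nnsfun_approx measurableT mf.
have mgZ n : measurable_fun [set: T] (fun w => (g n (Z w))%:E).
  by apply/measurable_EFinP; apply: measurableT_comp.
have g0 n w : 0 <= (g n (Z w))%:E by rewrite lee_fin.
have gE n : \int[P]_w ((Y w)%:E * (g n (Z w))%:E) =
    c%:E * \int[P]_w (g n (Z w))%:E.
  pose s := fset_set (g n @` setT).
  have s0 (i : 'I_#|`s|) : 0 <= (s`_i)%R%:E.
    have : (s`_i)%R \in s by apply: mem_nth; rewrite ltn_ord.
    rewrite in_fset_set; last exact: fimfunP.
    by move=> /set_mem[z _ <-]; rewrite lee_fin.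
  pose B (i : 'I_#|`s|) := g n @^-1` [set (s`_i)%R].
  have mB i : measurable (B i) by exact: measurable_funPTI.
  have mBZ i : measurable_fun [set: T] (fun w => (\1_(B i) (Z w) : R)%:E).
    by apply/measurable_EFinP; apply: measurableT_comp.
  have BZ0 i w : 0 <= (\1_(B i) (Z w) : R)%:E by rewrite lee_fin.
  have gsum w : (g n (Z w))%:E = \sum_(i < #|`s|)
      (s`_i)%:E * (\1_(B i) (Z w))%:E.
    by rewrite fimfunEord -sumEFin; apply: eq_bigr => i _; rewrite EFinM.
  have gYsum w : (Y w)%:E * (g n (Z w))%:E = \sum_(i < #|`s|)
      (s`_i)%:E * (Y w * \1_(B i) (Z w))%:E.
    rewrite gsum ge0_sume_distrr => [|i _]; last exact: mule_ge0.
    by apply: eq_bigr => i _; rewrite muleCA EFinM.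
  have mYB i : measurable_fun [set: T] (fun w => (Y w * \1_(B i) (Z w))%:E).
    by under eq_fun do rewrite EFinM; exact: emeasurable_funM.
  have YB0 i w : 0 <= (Y w * \1_(B i) (Z w))%:E.
    by rewrite EFinM mule_ge0.
  under eq_integral do rewrite gYsum.
  under [in RHS]eq_integral do rewrite gsum.
  rewrite !ge0_integral_sum//; last 4 first.
  - by move=> i; exact: measurable_funeM.
  - by move=> i w _; rewrite mule_ge0.
  - by move=> i; exact: measurable_funeM.
  - by move=> i w _; rewrite mule_ge0.
  rewrite ge0_sume_distrr; last first.
    by move=> i _; apply: integral_ge0 => w _; rewrite mule_ge0.
  apply: eq_bigr => i _.
  by rewrite !ge0_integralZl// YA// muleCA.
have gY n : measurable_fun [set: T] (fun w => (Y w)%:E * (g n (Z w))%:E).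
  exact: emeasurable_funM.
have glim z : (g n z)%:E @[n --> \oo] --> f z.
  exact: (cvg_nnsfun_approx measurableT mf).
have gnd z : nondecreasing_seq (fun n => (g n z)%:E).
  by move=> m n mn; rewrite lee_fin; exact/lefP/nd_nnsfun_approx.
have L1 : \int[P]_w (g n (Z w))%:E @[n --> \oo] --> \int[P]_w f (Z w).
  rewrite (_ : \int[P]_w f (Z w) = \int[P]_w limn (fun n => (g n (Z w))%:E)).
    by apply: cvg_monotone_convergence => // w _; exact: gnd.
  by apply: eq_integral => w _; apply/esym/cvg_lim => //; exact: glim.
have L2 : \int[P]_w ((Y w)%:E * (g n (Z w))%:E) @[n --> \oo] -->
    \int[P]_w ((Y w)%:E * f (Z w)).
  rewrite (_ : \int[P]_w ((Y w)%:E * f (Z w)) =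
      \int[P]_w limn (fun n => (Y w)%:E * (g n (Z w))%:E)).
    apply: cvg_monotone_convergence => //.
    - by move=> n w _; rewrite mule_ge0.
    - by move=> w _ m n mn; apply: lee_wpmul2l => //; exact: gnd.
  apply: eq_integral => w _; apply/esym/cvg_lim => //.
  by apply: cvgeZl => //; exact: glim.
have L3 : c%:E * \int[P]_w (g n (Z w))%:E @[n --> \oo] -->
    c%:E * \int[P]_w f (Z w) by apply: cvgeZl.
move: L2; rewrite (funext gE) => L2.
exact: (cvg_unique _ L2 L3).
Qed.

(* The product rule for sets is upgraded to functions one factor at a time:
   [s] lists the factors that are not yet known to be indicators. *)
Lemma integral_prod_indep (n : nat) (Z : 'I_n -> T -> S) (f : 'I_n -> S -> R)
    (m : 'I_n -> R) :
  (forall i, measurable_fun [set: T] (Z i)) ->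
  (forall A : 'I_n -> set S, (forall i, measurable (A i)) ->
    P (\bigcap_(i in [set: 'I_n]) (Z i @^-1` A i)) =
      \prod_(i < n) P (Z i @^-1` A i)) ->
  (forall i, measurable_fun [set: S] (f i)) ->
  (forall i z, (0 <= f i z)%R) ->
  (forall i, \int[P]_w (f i (Z i w))%:E = (m i)%:E) ->
  \int[P]_w (\prod_(i < n) f i (Z i w))%:E = (\prod_(i < n) m i)%:E.
Proof.
move=> mZ ind.
pose V := [set g : S -> R |
  measurable_fun [set: S] g /\ forall z, (0 <= g z)%R].
suff main (s : seq 'I_n) (h : 'I_n -> S -> R) (k : 'I_n -> R) :
    (forall i, V (h i)) ->
    (forall i, \int[P]_w (h i (Z i w))%:E = (k i)%:E) ->
    (forall i, i \notin s -> exists2 A, measurable A & h i = \1_A) ->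
    \int[P]_w (\prod_(i < n) h i (Z i w))%:E = (\prod_(i < n) k i)%:E.
  move=> mf f0 fm; apply: (main (enum 'I_n)) => // i.
  by rewrite mem_enum.
elim: s h k => [|a s IH] h k Vh hk hA.
  have {hA} /choice[A AP] : forall i, exists A, measurable A /\ h i = \1_A.
    by move=> i; have [//|A mA hE] := hA i; exists A.
  transitivity (\int[P]_w
      (\1_(\bigcap_(i in [set: 'I_n]) (Z i @^-1` A i)) w : R)%:E).
    apply: eq_integral => w _; congr EFin.
    have [wA|wA] := boolP (w \in \bigcap_(i in [set: 'I_n]) (Z i @^-1` A i)).
      rewrite indicE wA big1// => i _; rewrite (AP i).2 indicE mem_set//.
      by move/set_mem : wA => /(_ i I).
    rewrite indicE (negbTE wA).
    have [i /negP wi] : exists i, ~ (Z i w \in A i).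
      apply: contrapT => nw; move/negP : wA; apply; apply/mem_set => i _.
      by apply/set_mem; apply: contrapT => nA; apply: nw; exists i.
    by rewrite (bigD1 i)//= (AP i).2 indicE (negbTE wi) mul0r.
  have mZA i : measurable (Z i @^-1` A i).
    by rewrite -[X in measurable X]setTI; apply: mZ => //; exact: (AP i).1.
  rewrite integral_indic//; last first.
    by apply: fin_bigcap_measurable => // i _; exact: mZA.
  rewrite setIT; transitivity (\prod_(i < n) P (Z i @^-1` A i)).
    by apply: ind => i; exact: (AP i).1.
  rewrite -prodEFin; apply: eq_bigr => i _; rewrite -hk (AP i).2.
  transitivity (\int[P]_w (\1_(Z i @^-1` A i) w : R)%:E) => //.
  by rewrite integral_indic// setIT.
have k0 i : (0 <= k i)%R.
  rewrite -lee_fin -hk; apply: integral_ge0 => w _; rewrite lee_fin.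
  exact: (Vh i).2.
have mhZ i : measurable_fun [set: T] (fun w => h i (Z i w)).
  by apply: measurableT_comp => //; exact: (Vh i).1.
pose Y w := (\prod_(i < n | i != a) h i (Z i w))%R.
have Y0 w : (0 <= Y w)%R by apply: prodr_ge0 => i _; exact: (Vh i).2.
have mY : measurable_fun [set: T] Y.
  rewrite /Y; under eq_fun do rewrite big_mkcond/=.
  by apply: measurable_prod => i _; case: (i != a) => //; exact: measurable_cst.
pose c := (\prod_(i < n | i != a) k i)%R.
under eq_integral do rewrite (bigD1 a)//= mulrC EFinM.
rewrite [in RHS](bigD1 a)//= mulrC EFinM -(hk a).
apply: (@ge0_integralM_comp Y (Z a) c (EFin \o h a)) => //.
- exact: prodr_ge0.
- move=> A mA.
  have mI : measurable_fun [set: S] (\1_A : S -> R) by exact: measurable_indic.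
  have IE : \int[P]_w (\1_A (Z a w) : R)%:E = (fine (P (Z a @^-1` A)))%:E.
    transitivity (\int[P]_w (\1_(Z a @^-1` A) w : R)%:E) => //.
    have mZA : measurable (Z a @^-1` A).
      by rewrite -[X in measurable X]setTI; apply: mZ.
    by rewrite integral_indic// setIT fineK// fin_num_measure.
  rewrite IE -EFinM.
  (* With an indicator in place of the factor [a], the induction hypothesis for [s] applies. *)
  pose h' i := if i == a then \1_A : S -> R else h i.
  pose k' i := if i == a then fine (P (Z a @^-1` A)) else k i.
  have -> : (c * fine (P (Z a @^-1` A)) = \prod_(i < n) k' i)%R.
    rewrite (bigD1 a)//= {1}/k' eqxx mulrC; congr (_ * _)%R.
    by apply: eq_bigr => i /negbTE ia; rewrite /k' ia.
  rewrite -(IH h' k').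
  + apply: eq_integral => w _; rewrite [in RHS](bigD1 a)//= {1}/h' eqxx mulrC.
    by congr (_ * _)%:E; apply: eq_bigr => i /negbTE ia; rewrite /h' ia.
  + by move=> i; rewrite /h'; case: ifP => // _; split.
  + by move=> i; rewrite /h' /k'; case: ifPn => // /eqP ->.
  + move=> i si; rewrite /h'; case: ifPn => [_|ia]; first by exists A.
    by apply: hA; rewrite inE negb_or ia.
- by apply/measurable_EFinP; exact: (Vh a).1.
- by move=> z; rewrite lee_fin; exact: (Vh a).2.
Qed.

End ProductRule.

(** * Exponential Markov inequality and union bound *)

Section Chernoff.
Context {d : measure_display} {T : measurableType d} {R : realType}.
Variable P : probability T R.

Lemma measurable_ge_set (X : T -> R) (s : R) : measurable_fun [set: T] X ->
  measurable [set w | s <= X w].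
Proof.
move=> mX; rewrite (_ : [set _ | _] = X @^-1` `[s, +oo[); last first.
  by apply/seteqP; split => w /=; rewrite in_itv/= andbT.
by rewrite -[X in measurable X]setTI; apply: mX.
Qed.

Lemma exp_markov (X : T -> R) (c s : R) : measurable_fun [set: T] X ->
  (\int[P]_w (expR (X w))%:E <= (expR c)%:E)%E ->
  (P [set w | (s <= X w)%R] <= (expR (c - s))%:E)%E.
Proof.
move=> mX Xc; have mA := measurable_ge_set s mX.
have me : measurable_fun [set: T] (fun w => (expR (X w))%:E).
  by apply/measurable_EFinP; apply: measurableT_comp.
rewrite -[X in P X]setIT -integral_indic// expRD EFinM muleC.
apply: le_trans (lee_wpmul2l _ Xc); last by rewrite lee_fin expR_ge0.
rewrite -ge0_integralZl ?lee_fin ?expR_ge0//.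
apply: ge0_le_integral => //.
- by apply/measurable_EFinP; exact: measurable_indic.
- exact: measurable_funeM.
move=> w _; rewrite -EFinM lee_fin indicE.
have [/set_mem /= sX|_] := boolP (w \in _); last by rewrite mulr_ge0// expR_ge0.
by rewrite -expRD -[leLHS]expR0 ler_expR; lra.
Qed.

Lemma probability_bigcup_le (I : finType) (A : I -> set T) (b : R) :
  (forall i, measurable (A i)) -> (forall i, (P (A i) <= b%:E)%E) ->
  (P (\bigcup_i A i) <= (#|I|%:R * b)%:E)%E.
Proof.
move=> mA Ab.
rewrite (_ : \bigcup_i A i = \bigcup_(i in [set` enum I]) A i); last first.
  by apply/seteqP; split => [w [i _ Aw]|w [i _ Aw]]; exists i => //=; rewrite mem_enum.
rewrite bigcup_seq cardE.
elim: (enum I) => [|i s IH]; first by rewrite big_nil measure0 mul0r.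
rewrite big_cons; apply: le_trans (measureU2 _ _ _) _ => //.
  by apply: bigsetU_measurable.
by rewrite /= -natr1 mulrDl mul1r addrC EFinD leeD.
Qed.

End Chernoff.

(** * Chernoff's inequality for sums over independent copies *)

Section Copies.
Context {d0 d ds : measure_display} {T0 : measurableType d0}
  {T : measurableType d} {S : measurableType ds} {R : realType}.
Variables (P0 : probability T0 R) (P : probability T R).
Variables (z : {RV P0 >-> S}) (n : nat) (Z : 'I_n -> {RV P >-> S}).
Hypothesis indep : independent_copies z Z.

Lemma integral_copy (i : 'I_n) (f : S -> \bar R) :
  measurable_fun [set: S] f -> (forall x, 0 <= f x)%E ->
  (\int[P]_w f (Z i w) = \int[P0]_w f (z w))%E.
Proof.
move=> mf f0; rewrite -[LHS]ge0_integral_distribution//.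
rewrite -[RHS]ge0_integral_distribution//.
by apply: eq_measure_integral => A mA _; exact: indep.1.
Qed.

Lemma chernoff_copies (f : S -> R) (c s : R) : measurable_fun [set: S] f ->
  (\int[P0]_w (expR (f (z w)))%:E <= (expR c)%:E)%E ->
  (P [set w | (s <= \sum_(i < n) f (Z i w))%R] <= (expR (n%:R * c - s))%:E)%E.
Proof.
move=> mf fc; have mZ i : measurable_fun [set: T] (Z i) by [].
have mef : measurable_fun [set: S] (fun x => expR (f x)).
  by apply: measurableT_comp.
have I0 : (0 <= \int[P0]_w (expR (f (z w)))%:E)%E.
  by apply: integral_ge0 => w _; rewrite lee_fin expR_ge0.
pose m := fine (\int[P0]_w (expR (f (z w)))%:E)%E.
have mE : (\int[P0]_w (expR (f (z w)))%:E = m%:E)%E.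
  by rewrite fineK// ge0_fin_numE// (le_lt_trans fc)// ltry.
apply: exp_markov; first by apply: measurable_sum => i; apply: measurableT_comp.
under eq_integral do rewrite expR_sum.
rewrite (integral_prod_indep (f := fun=> expR \o f) (m := fun=> m))//.
- rewrite lee_fin prodr_const card_ord expRM_natl.
  by rewrite lerXn2r// ?nnegrE ?expR_ge0 -?lee_fin -?mE.
- move=> A mA; have := indep.2 [set: 'I_n]%SET A mA.
  rewrite [in RHS](eq_bigl xpredT) => [<-|i]; last by rewrite finset.inE.
  congr (P _); apply/seteqP; split => w wA i _; apply: wA => //=.
  by rewrite finset.inE.
- by move=> _ x; exact: expR_ge0.
- move=> i; rewrite -mE; apply: (@integral_copy i (fun x => (expR (f x))%:E)).
    exact/measurable_EFinP.
  by move=> x; rewrite lee_fin expR_ge0.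
Qed.

End Copies.

(** * Elementary inequalities for the exponential *)

Section ExpInequalities.
Context {R : realType}.
Implicit Types x y z a : R.

Lemma sqr_le_expR x : 0 <= x -> x ^+ 2 <= 2 * expR x.
Proof.
move=> x0; have := expR_ge1Dxn 1 x0; rewrite (_ : 2`! = 2)%N//.
by have := sqr_ge0 x; lra.
Qed.

Lemma expr4_le_expR x : 0 <= x -> x ^+ 4 <= 24 * expR x.
Proof.
move=> x0; have := expR_ge1Dxn 3 x0; rewrite (_ : 4`! = 24)%N//.
have : 0 <= x ^+ 4 by rewrite exprn_ge0.
lra.
Qed.

Lemma le_expR x : 0 <= x -> x <= expR x.
Proof. by move=> x0; have := expR_ge1Dx x; lra. Qed.

Lemma sqr_le_scaled_expR y a : 0 < a ->
  y ^+ 2 <= 2 * a ^+ 2 * expR (`|y| / a).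
Proof.
move=> a0; have q0 : 0 <= `|y| / a by rewrite divr_ge0// ltW.
have := ler_wpM2l (sqr_ge0 a) (sqr_le_expR q0).
rewrite -exprMn (mulrC a) divfK ?gt_eqF// real_normK ?num_real//.
by rewrite mulrCA mulrA.
Qed.

Lemma expR_le1DM z : expR z <= 1 + z * expR z.
Proof.
have := expR_ge1Dx (- z); rewrite -(ler_pM2r (expR_gt0 z)) -expRD addNr expR0.
lra.
Qed.

(** Keeping [z] with coefficient exactly one lets a nonpositive mean be discarded after integration,
    so that only a second-order term remains. *)
Lemma expR_le_quadratic z : expR z <= 1 + z + z ^+ 2 * expR `|z|.
Proof.
have h1 := expR_le1DM z; have h2 := expR_ge1Dx z.
have [z0|z0] := leP 0 z.
  rewrite ger0_norm//; have : z * (expR z - 1) <= z * (z * expR z).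
    by rewrite ler_wpM2l//; lra.
  by lra.
have e1 : 1 <= expR `|z| by have := expR_ge1Dx `|z|; have := normr_ge0 z; lra.
have : (- z) * (1 - expR z) <= (- z) * (- z) by rewrite ler_wpM2l//; lra.
have : z ^+ 2 * 1 <= z ^+ 2 * expR `|z| by rewrite ler_wpM2l// sqr_ge0.
lra.
Qed.

(** [exp (- x) <= 1 / (1 + x)], and [(1 - x / 2) (1 + x) >= 1] on the unit interval. *)
Lemma expRN_le x : 0 <= x -> x <= 1 -> expR (- x) <= 1 - x / 2.
Proof.
move=> x0 x1; have h := expR_ge1Dx x.
rewrite expRN -[leLHS]mul1r ler_pdivrMr ?expR_gt0//.
have : (1 - x / 2) * (1 + x) <= (1 - x / 2) * expR x by rewrite ler_wpM2l//; lra.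
nra.
Qed.

End ExpInequalities.

(** * Real-valued means of integrable functions *)

Section Means.
Context {d : measure_display} {T : measurableType d} {R : realType}.
Variable P : probability T R.
Implicit Types f g : T -> R.

(** Bundling integrability with a real value lets means be added and compared in [R] instead of the
    extended reals. *)
Definition has_mean f (m : R) : Prop :=
  P.-integrable [set: T] (EFin \o f) /\ (\int[P]_w (f w)%:E = m%:E)%E.

Lemma has_mean_cst (a : R) : has_mean (fun=> a) a.
Proof.
split; first exact: finite_measure_integrable_cst.
by rewrite integral_cst//= probability_setT mule1.
Qed.

Lemma has_meanD f g a b : has_mean f a -> has_mean g b ->
  has_mean (fun w => f w + g w) (a + b).
Proof.
move=> [fi fa] [gi gb]; split; first by have := integrableD measurableT fi gi.
by have := integralD_EFin measurableT fi gi; rewrite /= fa gb.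
Qed.

Lemma has_meanZ f a k : has_mean f a -> has_mean (fun w => k * f w) (k * a).
Proof.
move=> [fi fa]; split; first by have := integrableZl measurableT k fi.
by have := integralZl measurableT fi k; rewrite /= fa.
Qed.

Lemma has_mean_sum (I : Type) (s : seq I) (F : I -> T -> R) (m : I -> R) :
  (forall i, has_mean (F i) (m i)) ->
  has_mean (fun w => \sum_(i <- s) F i w) (\sum_(i <- s) m i).
Proof.
move=> Fm; elim: s => [|i s IH].
  rewrite big_nil; under eq_fun do rewrite big_nil; exact: has_mean_cst.
rewrite big_cons; under eq_fun do rewrite big_cons; exact: has_meanD.
Qed.

Lemma has_mean_dom f g b : measurable_fun [set: T] f -> has_mean g b ->
  (forall w, `|f w| <= g w) -> exists m, has_mean f m.
Proof.
move=> mf [gi gb] fg; exists (fine (\int[P]_w (f w)%:E)%E).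
have fi : P.-integrable [set: T] (EFin \o f).
  apply: le_integrable gi => //; first exact/measurable_EFinP.
  by move=> w _ /=; rewrite lee_fin (le_trans (fg w))// ler_norm.
by split=> //; rewrite fineK//; exact: integrable_fin_num.
Qed.

Lemma has_mean_ge0 f b : measurable_fun [set: T] f -> (forall w, 0 <= f w) ->
  (\int[P]_w (f w)%:E <= b%:E)%E -> exists2 m, has_mean f m & m <= b.
Proof.
move=> mf f0 fb; exists (fine (\int[P]_w (f w)%:E)%E).
  have fi : P.-integrable [set: T] (EFin \o f).
    apply/integrableP; split; first exact/measurable_EFinP.
    under eq_integral do rewrite /= ger0_norm//.
    by apply: le_lt_trans fb _; rewrite ltry.
  by split=> //; rewrite fineK//; exact: integrable_fin_num.
rewrite -lee_fin fineK// ge0_fin_numE; first by apply: le_lt_trans fb _; rewrite ltry.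
by apply: integral_ge0 => w _; rewrite lee_fin.
Qed.

(** Meant for exponentials [f], whose finite expectation is itself the conclusion. *)
Lemma le_mean f g m : measurable_fun [set: T] f -> (forall w, 0 <= f w) ->
  has_mean g m -> (forall w, f w <= g w) -> (\int[P]_w (f w)%:E <= m%:E)%E.
Proof.
move=> mf f0 [gi <-] fg; apply: ge0_le_integral => //.
- by move=> w _; rewrite lee_fin.
- exact/measurable_EFinP.
- exact: measurable_int gi.
- by move=> w _; rewrite lee_fin.
Qed.

Lemma le_has_mean f g a b : has_mean f a -> has_mean g b ->
  (forall w, f w <= g w) -> a <= b.
Proof.
move=> [fi fa] [gi gb] fg; rewrite -lee_fin -fa -gb.
by apply: le_integral => // w _; rewrite lee_fin.
Qed.

(** * Exponential moments of Huber-type and clipped squares *)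

Section MomentGeneratingFunctions.
Variables (w : T -> R) (a : R).
Hypotheses (mw : measurable_fun [set: T] w) (a0 : 0 < a).
Hypothesis w2 : (\int[P]_x (expR (`|w x| / a))%:E <= 2%:E)%E.

Let me : measurable_fun [set: T] (fun x => expR (`|w x| / a)).
Proof.
apply: measurableT_comp => //; apply: measurable_funM => //.
exact: measurableT_comp.
Qed.

Lemma exp_has_mean : exists2 m, has_mean (fun x => expR (`|w x| / a)) m & m <= 2.
Proof. by apply: has_mean_ge0 => // x; exact: expR_ge0. Qed.

Let q0 x : 0 <= `|w x| / a.
Proof. by rewrite divr_ge0// ltW. Qed.

Let wE x : `|w x| = a * (`|w x| / a).
Proof. by rewrite mulrC divfK// gt_eqF. Qed.

(* [(2 b a)^-1 * min (w^2, b |w|) <= |w| / (2 a)], which leaves room for the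
   factor [w^2 <= C a^2 exp (|w| / (2 a))]. *)
Lemma mgf_huber (b : R) : 0 < b ->
  (\int[P]_x (expR ((2 * b * a)^-1 * Num.min (w x ^+ 2) (b * `|w x|)))%:E
    <= (expR (8 * a / b))%:E)%E.
Proof.
move=> b0; have [m em m2] := exp_has_mean.
have := has_meanD (has_mean_cst 1) (has_meanZ (4 * a / b) em).
move=> /le_mean; move=> /(_ (fun x => expR ((2 * b * a)^-1 *
  Num.min (w x ^+ 2) (b * `|w x|)))) H.
apply: (@le_trans _ _ (1 + 4 * a / b * m)%:E).
  apply: H => [|x|x]; last 2 first.
  - exact: expR_ge0.
  - set th := Num.min _ _; set q := `|w x| / a.
    have th0 : 0 <= th by rewrite le_min sqr_ge0 mulr_ge0// ltW.
    have thw : th <= w x ^+ 2 by rewrite ge_min lexx.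
    have thb : th <= b * `|w x| by rewrite ge_min lexx orbT.
    have ba0 : 0 < 2 * b * a by rewrite !mulr_gt0.
    have lq : (2 * b * a)^-1 * th <= q / 2.
      rewrite ler_pdivrMl//; apply: le_trans thb _; rewrite wE -/q.
      by have -> : 2 * b * a * (q / 2) = b * (a * q) by field.
    apply: le_trans (expR_le1DM _) _; rewrite lerD2l.
    apply: (@le_trans _ _ ((2 * b * a)^-1 * (w x ^+ 2) * expR (q / 2))).
      have ba1 : 0 <= (2 * b * a)^-1 by rewrite invr_ge0 ltW.
      apply: ler_pM; rewrite ?expR_ge0 ?ler_expR//; first exact: mulr_ge0.
      exact: ler_wpM2l.
    rewrite -(real_normK (num_real (w x))) wE -/q.
    have -> : (2 * b * a)^-1 * (a * q) ^+ 2 = 2 * a / b * (q / 2) ^+ 2.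
      by field; rewrite !gt_eqF.
    have -> : 4 * a / b * expR q = 2 * a / b * (2 * expR (q / 2)) * expR (q / 2).
      by rewrite {1}(splitr q) expRD; field; rewrite gt_eqF.
    have ab1 : 0 <= 2 * a / b by rewrite ltW// divr_gt0// mulr_gt0.
    rewrite ler_wpM2r ?expR_ge0// ler_wpM2l//.
    by apply: sqr_le_expR; rewrite divr_ge0// q0.
  apply: measurableT_comp => //; apply: measurable_funM => //.
  apply: measurable_minr; first exact: measurable_funX.
  by apply: measurable_funM => //; exact: measurableT_comp.
rewrite lee_fin; apply: le_trans (expR_ge1Dx _); rewrite lerD2l.
have ab0 : 0 <= 4 * a / b by rewrite divr_ge0 ?mulr_ge0 ?ltW.
by have := ler_wpM2l ab0 m2; lra.
Qed.

(** The clipped square over [tau^2] lies in the unit interval, so a lower bound on its mean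
    suffices. Clipping loses at most [w^4 / (4 tau^2)], whose mean is at most [12 a^4 / tau^2]; the
    condition on [a], [rho] and [tau] makes this at most half of [rho]. *)
Lemma mgf_clipsq (rho tau : R) : 0 < tau ->
  has_mean (fun x => w x ^+ 2) rho -> 24 * a ^+ 4 <= rho * tau ^+ 2 ->
  (\int[P]_x (expR (- (clipsq tau (w x) / tau ^+ 2)))%:E
    <= (expR (- (rho / (4 * tau ^+ 2))))%:E)%E.
Proof.
move=> t0 wrho arho; have [m em m2] := exp_has_mean.
have [t2 t2E] : {t2 | tau ^+ 2 = t2} by exists (tau ^+ 2).
have t20 : 0 < t2 by rewrite -t2E exprn_gt0.
rewrite t2E in arho *.
have gm := has_meanD (has_meanD (has_mean_cst 1) (has_meanZ (- (2 * t2)^-1) wrho))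
  (has_meanZ (3 * a ^+ 4 / t2 ^+ 2) em).
apply: le_trans (le_mean _ _ gm _) _ => [|x|x|].
- apply: measurableT_comp => //; apply: measurable_funN.
  apply: measurable_funM => //; apply: measurable_minr => //.
  exact: measurable_funX.
- exact: expR_ge0.
- have c0 := clipsq_ge0 tau (w x).
  have c1 : clipsq tau (w x) <= t2 by rewrite -t2E ge_min lexx orbT.
  have d0 : 0 <= clipsq tau (w x) / t2 by rewrite divr_ge0// ltW.
  have d1 : clipsq tau (w x) / t2 <= 1 by rewrite ler_pdivrMr// mul1r.
  apply: le_trans (expRN_le d0 d1) _.
  (* The parabola [y - y^2 / (4 t2)] has maximum [t2], so at [y = w^2] it lies below both branches
     of the minimum. *)
  have c2 : w x ^+ 2 - (w x ^+ 2) ^+ 2 / (4 * t2) <= clipsq tau (w x).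
    rewrite le_min t2E gerBl divr_ge0 ?sqr_ge0 ?mulr_ge0 ?(ltW t20)//=.
    rewrite -subr_ge0 (_ : _ - _ = (w x ^+ 2 / 2 - t2) ^+ 2 / t2); last first.
      by field; rewrite gt_eqF.
    by rewrite divr_ge0 ?sqr_ge0 ?(ltW t20).
  have c3 : (w x ^+ 2) ^+ 2 <= 24 * a ^+ 4 * expR (`|w x| / a).
    have := expr4_le_expR (q0 x); rewrite -(ler_pM2l (exprn_gt0 4 a0)).
    rewrite -exprMn -wE (exprM _ 2 2) real_normK ?num_real// mulrCA mulrA.
    by rewrite mulrC.
  have c4 : (w x ^+ 2) ^+ 2 / (8 * t2 ^+ 2) <= 3 * a ^+ 4 / t2 ^+ 2 * expR (`|w x| / a).
    rewrite ler_pdivrMr ?mulr_gt0 ?exprn_gt0//; apply: le_trans c3 _.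
    by rewrite le_eqVlt; apply/orP; left; apply/eqP; field; rewrite gt_eqF.
  have c5 : (w x ^+ 2 - (w x ^+ 2) ^+ 2 / (4 * t2)) / t2 / 2 <=
      clipsq tau (w x) / t2 / 2.
    by rewrite !ler_pM2r ?invr_gt0.
  have c6 : (w x ^+ 2 - (w x ^+ 2) ^+ 2 / (4 * t2)) / t2 / 2 =
    (2 * t2)^-1 * w x ^+ 2 - (w x ^+ 2) ^+ 2 / (8 * t2 ^+ 2).
    by field; rewrite gt_eqF.
  lra.
rewrite lee_fin; apply: le_trans (expR_ge1Dx _).
have k0 : 0 <= 3 * a ^+ 4 / t2 ^+ 2.
  by rewrite divr_ge0 ?mulr_ge0 ?exprn_ge0 ?(ltW a0) ?(ltW t20).
have h1 := ler_wpM2l k0 m2.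
have h2 : 6 * a ^+ 4 / t2 ^+ 2 <= rho / (4 * t2).
  rewrite ler_pdivrMr ?exprn_gt0//.
  rewrite (_ : rho / (4 * t2) * t2 ^+ 2 = rho * t2 / 4); last by field; rewrite gt_eqF.
  lra.
have h3 : (2 * t2)^-1 * rho = 2 * (rho / (4 * t2)) by field; rewrite gt_eqF.
lra.
Qed.

End MomentGeneratingFunctions.
End Means.

(** * Exponential moment of the truncated product of noise and design *)

Section TruncatedProduct.
Context {d : measure_display} {T : measurableType d} {R : realType}.
Variable P : probability T R.

(* The truncation bias [E |xi| 1_(|xi| > M) |w| <= E xi^2 |w| / M], with
   [M = 4 s N], is of the same order [1 / N^2] as the quadratic term. *)
Lemma mgf_truncated_product (xi w : T -> R) (s a N mu : R) :
  measurable_fun [set: T] xi -> measurable_fun [set: T] w ->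
  0 < s -> 0 < a -> 0 < N ->
  (\int[P]_x (expR (`|xi x| / s))%:E <= 2%:E)%E ->
  (\int[P]_x (expR (`|w x| / a))%:E <= 2%:E)%E ->
  has_mean P (fun x => xi x * w x) mu -> mu <= 0 ->
  (\int[P]_x (expR ((16 * s * a * N)^-1 *
     (if `|xi x| <= 4 * s * N then xi x * w x else 0)))%:E
    <= (expR (3 / N ^+ 2))%:E)%E.
Proof.
move=> mxi mw s0 a0 N0 xi2 w2 xwmu mu0.
have [m1 e1 m12] := exp_has_mean mxi xi2.
have [m2 e2 m22] := exp_has_mean mw w2.
set lam := (16 * s * a * N)^-1.
have lam0 : 0 < lam by rewrite invr_gt0 !mulr_gt0.
have N20 : 0 < N ^+ 2 by rewrite exprn_gt0.
have gm := has_meanD (has_meanD (has_mean_cst P 1) (has_meanZ lam xwmu))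
  (has_meanZ (5 / (8 * N ^+ 2)) (has_meanD e1 e2)).
apply: le_trans (le_mean _ _ gm _) _ => [|x|x|].
- apply: measurableT_comp => //; apply: measurable_funM => //.
  apply: measurable_fun_ifT => //; last exact: measurable_funM.
  by apply: measurable_fun_ler => //; exact: measurableT_comp.
- exact: expR_ge0.
- set f := if _ then _ else _.
  have [X XE] : {X | `|xi x| / s = X} by exists (`|xi x| / s).
  have [q qE] : {q | `|w x| / a = q} by exists (`|w x| / a).
  rewrite XE qE.
  have X0 : 0 <= X by rewrite -XE divr_ge0// ltW.
  have q0 : 0 <= q by rewrite -qE divr_ge0// ltW.
  have xiE : `|xi x| = s * X by rewrite -XE mulrC divfK// gt_eqF.
  have wE : `|w x| = a * q by rewrite -qE mulrC divfK// gt_eqF.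
  (* Every error term is bounded by a multiple of [A * B], hence by the mean of [exp X] and [exp q]:
     marginal exponential moments suffice, whatever the dependence between [xi] and [w]. *)
  pose A := expR (X / 2); pose B := expR (q / 2).
  have A0 : 0 < A := expR_gt0 _; have B0 : 0 < B := expR_gt0 _.
  have AX : X ^+ 2 <= 8 * A.
    by have := @sqr_le_expR _ (X / 2); rewrite -/A; lra.
  have Bq : q <= 2 * B by have := @le_expR _ (q / 2); rewrite -/B; lra.
  have q4 : q ^+ 2 <= 32 * expR (q / 4).
    by have := @sqr_le_expR _ (q / 4); lra.
  (* Where the truncation acts, [X / (4 N) > 1]; inserting this factor turns a bias of order [1 / N]
     into one of order [1 / N^2]. *)
  have lf : lam * f <= lam * (xi x * w x) + X ^+ 2 * q / (64 * N ^+ 2).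
    rewrite /f; case: ifPn => [_|].
      by rewrite lerDl divr_ge0 ?mulr_ge0 ?sqr_ge0 ?(ltW N0) ?(ltW N20).
    rewrite -ltNge xiE => gtX.
    have gX : 4 * N < X by rewrite -(ltr_pM2l s0); lra.
    have : - (lam * (xi x * w x)) <= X * q / (16 * N).
      rewrite -mulrN; apply: (@le_trans _ _ (lam * `|xi x * w x|)).
        by rewrite ler_wpM2l ?(ltW lam0)// -normrN ler_norm.
      rewrite normrM xiE wE /lam le_eqVlt; apply/orP; left; apply/eqP.
      by field; rewrite !gt_eqF.
    have : X * q / (16 * N) <= X ^+ 2 * q / (64 * N ^+ 2).
      rewrite (_ : X ^+ 2 * q / (64 * N ^+ 2) = X * q / (16 * N) * (X / (4 * N))).
        rewrite ler_peMr//; first by rewrite divr_ge0 ?mulr_ge0 ?(ltW N0).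
        by rewrite ler_pdivlMr ?mul1r ?(ltW gX)// mulr_gt0.
      by field; rewrite gt_eqF.
    lra.
  (* Below the truncation level [X <= 4 N], so the 16 in [lam] brings the exponent down to [q / 4]
     and leaves room for the factor [q^2]. *)
  have absf : `|lam * f| <= q / 4 /\ (lam * f) ^+ 2 <= X ^+ 2 * q ^+ 2 / (256 * N ^+ 2).
    rewrite /f; case: ifPn => [leX|_]; last first.
      rewrite mulr0 normr0 expr0n/=; split; first by rewrite divr_ge0.
      by apply: divr_ge0; apply: mulr_ge0; rewrite ?sqr_ge0 ?ler0n.
    have lamE : `|lam * (xi x * w x)| = X * q / (16 * N).
      rewrite !normrM xiE wE gtr0_norm// /lam; by field; rewrite !gt_eqF.
    rewrite -(real_normK (num_real (lam * _))) lamE; split; last first.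
      by rewrite le_eqVlt; apply/orP; left; apply/eqP; field; rewrite gt_eqF.
    have lX : X <= 4 * N by rewrite -(ler_pM2l s0) -xiE; lra.
    rewrite ler_pdivrMr ?mulr_gt0//.
    have := ler_wpM2r q0 lX; lra.
  have [absf1 absf2] := absf.
  apply: le_trans (expR_le_quadratic _) _.
  have AB : A * B <= (expR X + expR q) / 2.
    have -> : expR X = A ^+ 2 by rewrite /A -expRM_natl; congr expR; field.
    have -> : expR q = B ^+ 2 by rewrite /B -expRM_natl; congr expR; field.
    by have := sqr_ge0 (A - B); lra.
  have t1 : X ^+ 2 * q / (64 * N ^+ 2) <= A * B / (4 * N ^+ 2).
    rewrite (_ : A * B / (4 * N ^+ 2) = (8 * A) * (2 * B) / (64 * N ^+ 2)); last first.
      by field; rewrite gt_eqF.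
    rewrite ler_wpM2r ?invr_ge0 ?mulr_ge0 ?(ltW N0) ?(ltW N20)//.
    by apply: ler_pM => //; exact: sqr_ge0.
  have t2 : (lam * f) ^+ 2 * expR `|lam * f| <= A * B / N ^+ 2.
    apply: (@le_trans _ _ (X ^+ 2 * q ^+ 2 / (256 * N ^+ 2) * expR (q / 4))).
      by apply: ler_pM; rewrite ?sqr_ge0 ?expR_ge0 ?ler_expR.
    have BE : B = expR (q / 4) * expR (q / 4).
      by rewrite /B -expRD; congr expR; field.
    have p256 : 0 <= (256 * N ^+ 2)^-1.
      by rewrite invr_ge0; apply: mulr_ge0; rewrite ?sqr_ge0 ?ler0n.
    rewrite (_ : A * B / N ^+ 2 =
        (8 * A) * (32 * expR (q / 4)) / (256 * N ^+ 2) * expR (q / 4)).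
      rewrite ler_wpM2r ?expR_ge0//; apply: (ler_wpM2r p256).
      by apply: ler_pM => //; exact: sqr_ge0.
    by rewrite BE; field; rewrite gt_eqF.
  (* [5 / 4] is the sum of [1 / 4] from the bias and [1] from the quadratic term. *)
  have t3 : A * B * (5 / (4 * N ^+ 2)) <= (expR X + expR q) / 2 * (5 / (4 * N ^+ 2)).
    by rewrite ler_wpM2r// divr_ge0 ?mulr_ge0 ?(ltW N0) ?(ltW N20).
  have t4 : A * B * (5 / (4 * N ^+ 2)) = A * B / (4 * N ^+ 2) + A * B / N ^+ 2.
    by field; rewrite gt_eqF.
  have t5 : (expR X + expR q) / 2 * (5 / (4 * N ^+ 2)) =
      5 / (8 * N ^+ 2) * (expR X + expR q) by field; rewrite gt_eqF.
  lra.
rewrite lee_fin; apply: le_trans (expR_ge1Dx _).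
have : lam * mu <= 0 by rewrite pmulr_rle0.
have : 5 / (8 * N ^+ 2) * (m1 + m2) <= 5 / (8 * N ^+ 2) * 4.
  by rewrite ler_wpM2l ?divr_ge0 ?mulr_ge0 ?(ltW N0) ?(ltW N20)//; lra.
have : 5 / (8 * N ^+ 2) * 4 <= 3 / N ^+ 2.
  rewrite (_ : 5 / (8 * N ^+ 2) * 4 = 5 / 2 / N ^+ 2); last by field; rewrite gt_eqF.
  by rewrite ler_wpM2r ?invr_ge0 ?(ltW N0) ?(ltW N20)//; lra.
lra.
Qed.

End TruncatedProduct.

(** * Measurability of coordinates, inner products and residuals *)

Section Measurability.
Context {R : realType} {p : nat}.

Lemma measurable_coord (j : 'I_p) :
  measurable_fun [set: Rvec R p] (fun x : Rvec R p => (x : 'rV[R]_p) ord0 j).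
Proof.
apply: (measurability _ (RGenOInfty.measurableE R)) => _ [_ [a ->] <-].
rewrite setTI; apply: sub_sigma_algebra.
apply: (@open_comp _ _ (fun x : 'rV[R]_p => x ord0 j)).
  by move=> x _; exact: coord_continuous.
exact: interval_open.
Qed.

Lemma measurable_dotv (v : 'rV[R]_p) :
  measurable_fun [set: Rvec R p] (fun x : Rvec R p => dotv x v).
Proof.
apply: measurable_sum => j; apply: measurable_funM => //.
exact: measurable_coord.
Qed.

Lemma measurable_dotv_fst (v : 'rV[R]_p) :
  measurable_fun [set: (Rvec R p * R)%type] (fun z : Rvec R p * R => dotv z.1 v).
Proof.
apply: (measurableT_comp (measurable_dotv v)); exact: measurable_fst.
Qed.

Lemma measurable_residual (b : 'rV[R]_p) :
  measurable_fun [set: (Rvec R p * R)%type] (fun z : Rvec R p * R => residual z b).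
Proof.
apply: measurable_funB; first exact: measurable_snd.
exact: measurable_dotv_fst.
Qed.

End Measurability.

(** * Consequences of psi-1 bounds and of isotropy *)

Section Psi1.
Context {d : measure_display} {T : measurableType d} {R : realType}.
Variable P : probability T R.

(** A strict inequality provides an admissible scale below [t] without knowing that the infimum is
    attained; larger scales remain admissible. *)
Lemma psi1_norm_lt (Z : T -> R) (t : R) : measurable_fun [set: T] Z ->
  (psi1_norm P Z < t%:E)%E ->
  0 < t /\ (\int[P]_w (expR (`|Z w| / t))%:E <= 2%:E)%E.
Proof.
move=> mZ /ereal_inf_lt[_ [s [s0 sE] <-]]; rewrite lte_fin => st.
have t0 : 0 < t by exact: lt_trans st.
split=> //; rewrite unlock in sE; apply: le_trans sE.
have mexp r : measurable_fun [set: T] (fun w => (expR (`|Z w| / r))%:E).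
  apply/measurable_EFinP; apply: measurableT_comp => //.
  by apply: measurable_funM => //; exact: measurableT_comp.
apply: ge0_le_integral => //.
move=> w _; rewrite lee_fin ler_expR ler_wpM2l// lef_pV2//; exact: ltW.
Qed.

Lemma psi1_norm_ge0 (Z : T -> R) : (0 <= psi1_norm P Z)%E.
Proof.
by apply: le_ereal_inf_tmp => _ [t [t0 _] <-]; rewrite lee_fin ltW.
Qed.

(** The factor 2 puts the scale strictly above the norm, as [psi1_norm_lt] requires. *)
Lemma psi1_norm_vec_exp p (x : T -> Rvec R p) (kappa Delta : R) (v : 'rV[R]_p) :
  measurable_fun [set: T] x -> 0 < kappa -> 0 < Delta ->
  (psi1_norm_vec P x <= kappa%:E)%E -> l2norm v <= Delta ->
  (\int[P]_w (expR (`|dotv (x w) v| / (2 * kappa * Delta)))%:E <= 2%:E)%E.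
Proof.
move=> mx k0 D0 xk vD.
have mdot u : measurable_fun [set: T] (fun w => dotv (x w) u).
  exact: (measurableT_comp (measurable_dotv u) mx).
have [v0|v0] := eqVneq (l2norm v) 0.
  have -> : v = 0 by apply: dotvv_eq0; rewrite -sqr_l2norm v0 expr0n.
  under eq_integral do rewrite dotv0r normr0 mul0r expR0.
  by rewrite integral_cst//= probability_setT mule1 lee_fin; lra.
have {}v0 : 0 < l2norm v by rewrite lt_neqAle eq_sym v0 l2norm_ge0.
pose u := (l2norm v)^-1 *: v.
have u1 : l2norm u = 1.
  by rewrite l2normZ ?invr_ge0 ?l2norm_ge0// mulVf// gt_eqF.
have vE : v = l2norm v *: u by rewrite scalerA mulfV ?scale1r// gt_eqF.
have : (psi1_norm P (fun w => dotv (x w) u) < (2 * kappa)%:E)%E.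
  apply: (@le_lt_trans _ _ kappa%:E); last by rewrite lte_fin; lra.
  by apply: le_trans xk; apply: ereal_sup_ubound; exists u.
move=> /(psi1_norm_lt (mdot u))[k20 uE]; apply: le_trans uE.
have mexp w r : measurable_fun [set: T] (fun y => (expR (`|dotv (x y) w| / r))%:E).
  apply/measurable_EFinP; apply: measurableT_comp => //.
  by apply: measurable_funM => //; exact: measurableT_comp.
apply: ge0_le_integral => //.
move=> w _; rewrite lee_fin ler_expR {1}vE dotvZr normrM ger0_norm ?(ltW v0)//.
rewrite ler_pdivrMr ?mulr_gt0//.
rewrite (_ : _ / (2 * kappa) * (2 * kappa * Delta) = Delta * `|dotv (x w) u|).
  by rewrite ler_wpM2r.
by field; rewrite gt_eqF.
Qed.

(** [isotropic] gives values of integrals; the mixed products are integrable because sums of two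
    squares dominate them, and the square then expands bilinearly. *)
Lemma isotropic_sqr p (x : T -> Rvec R p) (v : 'rV[R]_p) :
  measurable_fun [set: T] x -> isotropic P x ->
  has_mean P (fun w => dotv (x w) v ^+ 2) (dotv v v).
Proof.
move=> mx iso; pose c j w := (x w : 'rV[R]_p) ord0 j.
have mc j : measurable_fun [set: T] (c j).
  exact: (measurableT_comp (measurable_coord j) mx).
have E j k : (\int[P]_w (c j w * c k w)%:E = ((1%:M : 'M[R]_p) j k)%:E)%E.
  by rewrite -iso unlock.
have sq j : has_mean P (fun w => c j w ^+ 2) 1.
  have h : (\int[P]_w (c j w ^+ 2)%:E = 1%:E)%E.
    by have := E j j; rewrite mxE eqxx.
  have [m [mi _] _] : exists2 m, has_mean P (fun w => c j w ^+ 2) m & m <= 1.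
    apply: has_mean_ge0; first exact: measurable_funX.
      by move=> w; exact: sqr_ge0.
    by rewrite h.
  by split.
have cc j k : has_mean P (fun w => c j w * c k w) ((1%:M : 'M[R]_p) j k).
  have [m [mi _]] : exists m, has_mean P (fun w => c j w * c k w) m.
    apply: has_mean_dom (has_meanD (sq j) (sq k)) _; first exact: measurable_funM.
    move=> w; have := sqr_ge0 (c j w - c k w); have := sqr_ge0 (c j w + c k w).
    by rewrite ler_norml => h1 h2; apply/andP; split; nra.
  by split; last exact: E.
have := has_mean_sum (index_enum 'I_p) (fun j => has_mean_sum (index_enum 'I_p)
  (fun k => has_meanZ (v ord0 j * v ord0 k) (cc j k))).
rewrite (_ : \sum_j _ = dotv v v); last first.
  apply: eq_bigr => j _; rewrite (bigD1 j)//= big1 => [|k kj].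
    by rewrite mxE eqxx addr0 mulr1.
  by rewrite mxE eq_sym (negbTE kj) mulr0.
congr has_mean; apply/funext => w.
rewrite expr2 {1}/dotv mulr_suml; apply: eq_bigr => j _.
by rewrite mulr_sumr; apply: eq_bigr => k _; rewrite /c; ring.
Qed.

End Psi1.

(** * Optimality of the population minimizer and a lower bound on [kappa] *)

Section Optimality.
Context {R : realType} {p : nat} {d0 : measure_display} {T0 : measurableType d0}.
Variables (P0 : probability T0 R) (xy : {RV P0 >-> (Rvec R p * R)%type}).

Let mx : measurable_fun [set: T0] (fun w => (xy w).1).
Proof. by apply: (measurableT_comp measurable_fst). Qed.

Lemma measurable_dotv_xy (v : 'rV[R]_p) :
  measurable_fun [set: T0] (fun w => dotv (xy w).1 v).
Proof. exact: (measurableT_comp (measurable_dotv v) mx). Qed.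

Lemma measurable_residual_xy (b : 'rV[R]_p) :
  measurable_fun [set: T0] (fun w => residual (xy w) b).
Proof. by apply: (measurableT_comp (measurable_residual b)). Qed.

Lemma residual_segment (z : Rvec R p * R) (b v : 'rV[R]_p) (t : R) :
  residual z (t *: v + (1 - t) *: b) = residual z b - t * dotv z.1 (v - b).
Proof. by rewrite /residual dotvBr dotvDr !dotvZr; ring. Qed.

(** First-order optimality: along the segment from [b] to [v] the risk is a quadratic in [t] whose
    slope at zero is [- 2 mu], and this slope cannot be negative. *)
Lemma cross_moment_le0 (K : set 'rV[R]_p) (b v : 'rV[R]_p) (s : R) :
  convexK K -> minimizer_on K (risk P0 xy) b -> K v -> 0 < s ->
  (\int[P0]_w (expR (`|residual (xy w) b| / s))%:E <= 2%:E)%E ->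
  isotropic P0 (fun w => (xy w).1) ->
  exists2 mu, has_mean P0 (fun w => residual (xy w) b * dotv (xy w).1 (v - b)) mu
    & mu <= 0.
Proof.
move=> cK [Kb bmin] Kv s0 xi2 iso.
set xi := fun w => residual (xy w) b; set x := fun w => dotv (xy w).1 (v - b).
have mxi : measurable_fun [set: T0] xi := measurable_residual_xy b.
have mx' : measurable_fun [set: T0] x := measurable_dotv_xy (v - b).
have [m em _] := exp_has_mean mxi xi2.
have xm : has_mean P0 (fun w => x w ^+ 2) (dotv (v - b) (v - b)).
  exact: (isotropic_sqr (v - b) mx iso).
set om := dotv _ _ in xm.
have [q xiq] : exists q, has_mean P0 (fun w => xi w ^+ 2) q.
  apply: has_mean_dom (has_meanZ (2 * s ^+ 2) em) _; first exact: measurable_funX.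
  by move=> w; rewrite ger0_norm ?sqr_ge0//; exact: sqr_le_scaled_expR.
have [mu xmu] : exists mu, has_mean P0 (fun w => xi w * x w) mu.
  apply: has_mean_dom (has_meanD xiq xm) _; first exact: measurable_funM.
  move=> w /=; move: (xi w) (x w) => y z.
  have := sqr_ge0 (y - z); have := sqr_ge0 (y + z).
  by rewrite ler_norml => h1 h2; apply/andP; split; lra.
exists mu => //.
have opt t : 0 < t -> t <= 1 -> 2 * mu <= t * om.
  move=> t0 t1; have := bmin (t *: v + (1 - t) *: b).
  rewrite /risk !unlock => /(_ (cK _ _ _ _ Kv Kb)).
  rewrite (ltW t0) t1 => /(_ isT).
  under [in X in (_ <= X)%E]eq_integral do rewrite residual_segment.
  have := has_meanD (has_meanD xiq (has_meanZ (- (2 * t)) xmu))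
    (has_meanZ (t ^+ 2) xm).
  rewrite (_ : (fun w => _) = (fun w => (xi w - t * x w) ^+ 2)); last first.
    by apply/funext => w; ring.
  move=> [_ ->]; rewrite xiq.2 lee_fin => h.
  rewrite -(ler_pM2l t0); lra.
rewrite leNgt; apply/negP => mu0.
have om0 : 0 <= om := dotvv_ge0 _.
(* A step so short that [t * om < mu], against [2 * mu <= t * om]; adding 1 covers [om = 0]. *)
pose t := Num.min 1 (mu / (om + 1)).
have om1 : 0 < om + 1 by lra.
have t0 : 0 < t by rewrite lt_min ltr01 divr_gt0.
have t1 : t <= 1 by rewrite ge_min lexx.
have tm : t * (om + 1) <= mu by rewrite -ler_pdivlMr// ge_min lexx orbT.
have := opt t t0 t1; lra.
Qed.

(** Isotropy makes the second moment of [<x, v>] equal to [|v|^2], while the psi-1 bound caps it at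
    [(4 kappa)^2 |v|^2]. This allows powers of [kappa] to be raised at the expense of constants. *)
Lemma kappa_lower (kappa : R) (v : 'rV[R]_p) : 0 < kappa ->
  isotropic P0 (fun w => (xy w).1) ->
  (psi1_norm_vec P0 (fun w => (xy w).1) <= kappa%:E)%E ->
  0 < l2norm v -> 4^-1 <= kappa.
Proof.
move=> k0 iso xk v0; have xm := isotropic_sqr v mx iso.
have := psi1_norm_vec_exp mx k0 v0 xk (lexx _).
set a := 2 * kappa * l2norm v; have a0 : 0 < a by rewrite !mulr_gt0.
move=> /(exp_has_mean (measurable_dotv_xy v))[m em m2].
have /(le_has_mean xm (has_meanZ (2 * a ^+ 2) em)) : forall w,
    dotv (xy w).1 v ^+ 2 <= 2 * a ^+ 2 * expR (`|dotv (xy w).1 v| / a).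
  by move=> w; exact: sqr_le_scaled_expR.
rewrite -sqr_l2norm => h.
have h1 : l2norm v ^+ 2 * 1 <= l2norm v ^+ 2 * (4 * kappa) ^+ 2.
  have : 2 * a ^+ 2 * m <= 2 * a ^+ 2 * 2 by rewrite ler_wpM2l// mulr_ge0// sqr_ge0.
  by rewrite /a in h *; lra.
have h2 : 1 <= 4 * kappa.
  move: h1; rewrite ler_pM2l ?exprn_gt0// -[X in X <= _](expr1n _ 2).
  by rewrite ler_pXn2r ?nnegrE//; lra.
lra.
Qed.

End Optimality.

(** * Calculus of events of high probability *)

Section HighProbability.
Context {d : measure_display} {T : measurableType d} {R : realType}.
Variable P : probability T R.

Lemma holds_with_prob_ge_sub (r r' : R) (Q Q' : set T) : r' <= r -> Q `<=` Q' ->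
  holds_with_prob_ge P r Q -> holds_with_prob_ge P r' Q'.
Proof.
move=> rr QQ [E [mE EQ PE]]; exists E; split=> //; first exact: subset_trans QQ.
by apply: le_trans PE; rewrite lee_fin.
Qed.

Lemma holds_with_prob_geT (r : R) (Q : set T) : r <= 1 -> (forall w, Q w) ->
  holds_with_prob_ge P r Q.
Proof.
by move=> r1 QT; exists setT; split=> //; rewrite probability_setT lee_fin.
Qed.

Lemma holds_with_prob_geI (e1 e2 : R) (Q1 Q2 : set T) :
  holds_with_prob_ge P (1 - e1) Q1 -> holds_with_prob_ge P (1 - e2) Q2 ->
  holds_with_prob_ge P (1 - (e1 + e2)) (Q1 `&` Q2).
Proof.
move=> [E1 [m1 s1 h1]] [E2 [m2 s2 h2]]; exists (E1 `&` E2); split.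
- exact: measurableI.
- by move=> w [/s1 ? /s2].
have : (P (~` (E1 `&` E2)) <= P (~` E1) + P (~` E2))%E.
  by rewrite setCI; apply: measureU2; exact: measurableC.
rewrite !probability_setC//; last exact: measurableI.
have fin A : measurable A -> P A = (fine (P A))%:E.
  by move=> mA; rewrite fineK// fin_num_measure.
have mI := measurableI _ _ m1 m2.
rewrite (fin _ m1) lee_fin in h1; rewrite (fin _ m2) lee_fin in h2.
rewrite (fin _ m1) (fin _ m2) (fin _ mI) -!EFinB -EFinD !lee_fin; lra.
Qed.

Lemma holds_with_prob_ge_forall (I : finType) (B : I -> set T) (e : R) :
  (forall i, measurable (B i)) -> (forall i, (P (B i) <= e%:E)%E) ->
  holds_with_prob_ge P (1 - #|I|%:R * e) [set w | forall i, ~ B i w].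
Proof.
move=> mB Be; have mU : measurable (\bigcup_i B i).
  by apply: fin_bigcup_measurable => // i _; exact: mB.
exists (~` (\bigcup_i B i)); split.
- exact: measurableC.
- by move=> w nB i Bi; apply: nB; exists i.
rewrite probability_setC// EFinB leeB//.
exact: probability_bigcup_le.
Qed.

End HighProbability.

(** * The four random events, with [N] for [sqrt n], [L] for [log D] and [V] for the shifted
    vertices *)

Section GoodEvent.
Context {R : realType} {p n D : nat} {d0 d : measure_display}
  {T0 : measurableType d0} {T : measurableType d}.
Variables (P0 : probability T0 R) (P : probability T R).
Variables (xy : {RV P0 >-> (Rvec R p * R)%type})
  (XY : 'I_n -> {RV P >-> (Rvec R p * R)%type}).
Hypothesis indep : independent_copies xy XY.
Variables (b : 'rV[R]_p) (V : 'I_D -> 'rV[R]_p).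
Variables (kappa Delta s L N : R).
Hypotheses (k0 : 0 < kappa) (D0 : 0 < Delta) (s0 : 0 < s) (N1 : 1 <= N).
Hypothesis nN : n%:R = N ^+ 2.
Hypothesis DL : D%:R <= expR L.
Hypothesis iso : isotropic P0 (fun w => (xy w).1).
Hypothesis xkappa : (psi1_norm_vec P0 (fun w => (xy w).1) <= kappa%:E)%E.
Hypothesis xi2 : (\int[P0]_w (expR (`|residual (xy w) b| / s))%:E <= 2%:E)%E.
Hypothesis VD : forall j, l2norm (V j) <= Delta.

Let a := 2 * kappa * Delta.

Let a0 : 0 < a. Proof. by rewrite !mulr_gt0. Qed.

Let N0 : 0 < N. Proof. exact: lt_le_trans N1. Qed.

Let mx : measurable_fun [set: T0] (fun w => (xy w).1).
Proof. by apply: (measurableT_comp measurable_fst). Qed.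

Let wj2 j : (\int[P0]_w (expR (`|dotv (xy w).1 (V j)| / a))%:E <= 2%:E)%E.
Proof. exact: psi1_norm_vec_exp. Qed.

Let msum (f : Rvec R p * R -> R) : measurable_fun [set: (Rvec R p * R)%type] f ->
  measurable_fun [set: T] (fun w => \sum_(i < n) f (XY i w)).
Proof. by move=> mf; apply: measurable_sum => i; exact: measurableT_comp. Qed.

(** Each residual fails with probability at most [2 exp (- 4 N)]; the union over
    [n = N^2 <= 2 exp N] of them uses up one factor [exp N]. On this event the truncation in
    [multiplier_bounded] is inactive. *)
Lemma residuals_bounded : holds_with_prob_ge P (1 - 4 * expR (- (3 * N)))
  [set w | forall i, `|residual (XY i w) b| <= 4 * s * N].
Proof.
pose B i := [set w | 4 * N <= `|residual (XY i w) b| / s].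
have mB i : measurable_fun [set: T] (fun w => `|residual (XY i w) b| / s).
  apply: measurable_funM => //; apply: measurableT_comp => //.
  by apply: (measurableT_comp (measurable_residual b)).
have PB i : (P (B i) <= (2 * expR (- (4 * N)))%:E)%E.
  have := @exp_markov _ _ _ P _ (ln 2) (4 * N) (mB i).
  rewrite expRD lnK ?posrE//; apply.
  rewrite (integral_copy indep i (f := fun z => (expR (`|residual z b| / s))%:E))//.
  apply/measurable_EFinP; apply: measurableT_comp => //.
  apply: measurable_funM => //; apply: measurableT_comp => //.
  exact: measurable_residual.
have := holds_with_prob_ge_forall
  (fun i => measurable_ge_set (4 * N) (mB i)) PB.
apply: holds_with_prob_ge_sub => [|w h i].
  rewrite lerB// card_ord nN.
  have := sqr_le_expR (ltW N0); have := expR_gt0 (- (4 * N)).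
  have -> : expR (- (3 * N)) = expR N * expR (- (4 * N)).
    by rewrite -expRD; congr expR; ring.
  by move=> e0 eN; have := ler_wpM2r (ltW e0) eN; lra.
have /negP := h i; rewrite /= -ltNge ltr_pdivrMr// => /ltW; lra.
Qed.

(** Over [n = N^2] samples the exponent [3 / N^2] adds up to the constant 3; [L] pays for the union
    over the vertices. *)
Lemma multiplier_bounded (v : R) :
  (forall j, exists2 mu, has_mean P0
     (fun w => residual (xy w) b * dotv (xy w).1 (V j)) mu & mu <= 0) ->
  holds_with_prob_ge P (1 - expR (L + 3 - v))
    [set w | forall j, \sum_(i < n) (if `|residual (XY i w) b| <= 4 * s * N then
       residual (XY i w) b * dotv (XY i w).1 (V j) else 0)
       <= 16 * s * a * N * v].
Proof.
move=> cross; pose f j (z : Rvec R p * R) := (16 * s * a * N)^-1 *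
  (if `|residual z b| <= 4 * s * N then residual z b * dotv z.1 (V j) else 0).
have mf j : measurable_fun [set: (Rvec R p * R)%type] (f j).
  have mr := @measurable_residual R p b.
  apply: measurable_funM => //; apply: measurable_fun_ifT => //.
    by apply: measurable_fun_ler => //; exact: measurableT_comp.
  by apply: measurable_funM => //; exact: measurable_dotv_fst.
have lam0 : 0 < 16 * s * a * N by rewrite !mulr_gt0.
have PB j : (P [set w | (v <= \sum_(i < n) f j (XY i w))%R] <= (expR (3 - v))%:E)%E.
  have [mu xwmu mu0] := cross j.
  have := chernoff_copies indep v (mf j) (mgf_truncated_product
    (measurable_residual_xy xy b) (measurable_dotv_xy xy (V j))
    s0 a0 N0 xi2 (wj2 j) xwmu mu0).
  by rewrite nN mulrCA mulfV ?mulr1// gt_eqF// exprn_gt0.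
have := holds_with_prob_ge_forall
  (fun j => measurable_ge_set v (msum (mf j))) PB.
apply: holds_with_prob_ge_sub => [|w h j].
  rewrite lerB// card_ord (_ : L + 3 - v = L + (3 - v)) ?expRD; last by ring.
  by rewrite ler_wpM2r// expR_ge0.
have /negP := h j; rewrite /= -ltNge -mulr_sumr ltr_pdivrMl// => /ltW.
by rewrite mulrC.
Qed.

Lemma huber_bounded (bb : R) : 0 < bb ->
  holds_with_prob_ge P (1 - expR (- N))
    [set w | forall j, \sum_(i < n) Num.min (dotv (XY i w).1 (V j) ^+ 2)
       (bb * `|dotv (XY i w).1 (V j)|) <= 16 * n%:R * a ^+ 2 + 2 * bb * a * (L + N)].
Proof.
move=> bb0; pose f j (z : Rvec R p * R) := (2 * bb * a)^-1 *
  Num.min (dotv z.1 (V j) ^+ 2) (bb * `|dotv z.1 (V j)|).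
have mf j : measurable_fun [set: (Rvec R p * R)%type] (f j).
  have md := @measurable_dotv_fst R p (V j).
  apply: measurable_funM => //; apply: measurable_minr.
    exact: measurable_funX.
  by apply: measurable_funM => //; exact: measurableT_comp.
have lam0 : 0 < 2 * bb * a by rewrite !mulr_gt0.
(* The Chernoff exponent, then [L] for the union bound and [N] for the failure probability. *)
pose v := n%:R * (8 * a / bb) + (L + N).
have PB j : (P [set w | (v <= \sum_(i < n) f j (XY i w))%R] <= (expR (- (L + N)))%:E)%E.
  have := chernoff_copies indep v (mf j)
    (mgf_huber (measurable_dotv_xy xy (V j)) a0 (wj2 j) bb0).
  by rewrite /v opprD addNKr.
have := holds_with_prob_ge_forall
  (fun j => measurable_ge_set v (msum (mf j))) PB.
apply: holds_with_prob_ge_sub => [|w h j].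
  rewrite lerB// card_ord opprD expRD mulrA -[leRHS]mul1r ler_wpM2r ?expR_ge0//.
  by rewrite expRN ler_pdivrMr ?mul1r// expR_gt0.
have /negP := h j; rewrite /= -ltNge -mulr_sumr ltr_pdivrMl// => /ltW.
rewrite (_ : 2 * bb * a * v = 16 * n%:R * a ^+ 2 + 2 * bb * a * (L + N))//.
by rewrite /v; field; rewrite gt_eqF.
Qed.

(** [|g|^2 >= r^2 / 4] gives the Chernoff exponent [n r^2 / (16 tau^2)], half of which is kept for
    the union over [D^k] tuples; [|g|^2 <= 4 r^2] turns the fourth-moment condition of [mgf_clipsq]
    into [1536 kappa^4 r^2 <= tau^2]. *)
Lemma net_lower_bound (k : nat) (r tau : R) : (0 < k)%N -> 0 < r -> 0 < tau ->
  1536 * kappa ^+ 4 * r ^+ 2 <= tau ^+ 2 ->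
  k%:R * L + N <= n%:R * r ^+ 2 / (32 * tau ^+ 2) ->
  holds_with_prob_ge P (1 - expR (- N))
    [set w | forall t : k.-tuple 'I_D,
       let g := k%:R^-1 *: \sum_(j <- t) V j in
       r ^+ 2 / 4 <= dotv g g <= 4 * r ^+ 2 ->
       n%:R * r ^+ 2 / 32 <= \sum_(i < n) clipsq tau (dotv (XY i w).1 g)].
Proof.
move=> kp r0 t0 taur kL.
pose g (t : k.-tuple 'I_D) := k%:R^-1 *: \sum_(j <- t) V j.
pose f t (z : Rvec R p * R) := - (clipsq tau (dotv z.1 (g t)) / tau ^+ 2).
pose v := - (n%:R * r ^+ 2 / (32 * tau ^+ 2)).
have tau2 : 0 < tau ^+ 2 by rewrite exprn_gt0.
have mf t : measurable_fun [set: (Rvec R p * R)%type] (f t).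
  apply: measurable_funN; apply: measurable_funM => //; apply: measurable_minr => //.
  by apply: measurable_funX; exact: measurable_dotv_fst.
(* Tuples outside the shell get the empty event, so the union bound can run over all tuples. *)
pose B t := if r ^+ 2 / 4 <= dotv (g t) (g t) <= 4 * r ^+ 2
  then [set w | v <= \sum_(i < n) f t (XY i w)] else set0.
have mB t : measurable (B t).
  by rewrite /B; case: ifP => // _; apply: measurable_ge_set; exact: msum.
have PB t : (P (B t) <= (expR (- (k%:R * L + N)))%:E)%E.
  rewrite /B; case: ifPn => [/andP[glo ghi]|_]; last first.
    by rewrite measure0 lee_fin expR_ge0.
  have l0 : 0 < l2norm (g t).
    rewrite lt_neqAle l2norm_ge0 andbT eq_sym; apply/eqP => l0.
    move: glo; rewrite -sqr_l2norm l0 expr0n/= leNgt => /negP; apply.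
    by rewrite divr_gt0// exprn_gt0.
  have mgf := psi1_norm_vec_exp mx k0 l0 xkappa (lexx _).
  have a1 : 0 < 2 * kappa * l2norm (g t) by rewrite !mulr_gt0.
  have rho := isotropic_sqr (g t) mx iso.
  have cond : 24 * (2 * kappa * l2norm (g t)) ^+ 4 <= dotv (g t) (g t) * tau ^+ 2.
    rewrite !exprMn (exprM (l2norm _) 2 2) sqr_l2norm.
    have g0 := dotvv_ge0 (g t).
    have k4 : 0 <= 384 * kappa ^+ 4.
      by apply: mulr_ge0; [exact: ler0n|exact/exprn_ge0/ltW].
    have h : 384 * kappa ^+ 4 * dotv (g t) (g t) <= tau ^+ 2.
      by apply: le_trans (ler_wpM2l k4 ghi) _; lra.
    have := ler_wpM2l g0 h; lra.
  have := chernoff_copies indep v (mf t)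
    (mgf_clipsq (measurable_dotv_xy xy (g t)) a1 mgf t0 rho cond).
  move/le_trans; apply; rewrite lee_fin ler_expR /v opprK.
  have : n%:R * (r ^+ 2 / 4 / (4 * tau ^+ 2)) <=
         n%:R * (dotv (g t) (g t) / (4 * tau ^+ 2)).
    by rewrite ler_wpM2l// ler_pM2r// invr_gt0 mulr_gt0.
  rewrite (_ : n%:R * (r ^+ 2 / 4 / (4 * tau ^+ 2)) =
    2 * (n%:R * r ^+ 2 / (32 * tau ^+ 2))); last by field; rewrite gt_eqF.
  lra.
have := holds_with_prob_ge_forall mB PB.
apply: holds_with_prob_ge_sub => [|w h t /= gt].
  rewrite lerB// card_tuple card_ord opprD expRD mulrA.
  rewrite -[leRHS]mul1r ler_wpM2r ?expR_ge0//.
  rewrite expRN ler_pdivrMr ?expR_gt0// mul1r natrX expRM_natl.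
  by rewrite lerXn2r ?nnegrE ?expR_ge0.
have := h t; rewrite /B gt /= => /negP; rewrite -ltNge /f sumrN -mulr_suml /v.
rewrite ltrN2 ltr_pdivlMr// => /ltW.
rewrite (_ : n%:R * r ^+ 2 / (32 * tau ^+ 2) * tau ^+ 2 = n%:R * r ^+ 2 / 32)//.
by field; rewrite gt_eqF.
Qed.

End GoodEvent.

(** * Lower bound on the empirical quadratic form at radius [r] *)

Section Deterministic.
Context {R : realType} {p n D k : nat}.
Variables (x : 'I_n -> 'rV[R]_p) (V : 'I_D -> 'rV[R]_p).
Variables (c : 'I_D -> R) (kappa Delta r tau S : R).
Hypotheses (n0 : (0 < n)%N) (kp : (0 < k)%N) (t0 : 0 < tau) (r0 : 0 < r).
Hypothesis kappa_ge : 4^-1 <= kappa.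
Hypotheses (c0 : forall j, 0 <= c j) (c1 : \sum_j c j = 1).
Hypothesis VD : forall j, dotv (V j) (V j) <= Delta ^+ 2.
Hypothesis huber : forall j, \sum_(i < n) Num.min (dotv (x i) (V j) ^+ 2)
  (k%:R * tau * `|dotv (x i) (V j)|) <= S.
Hypothesis net : forall t : k.-tuple 'I_D,
  let g := k%:R^-1 *: \sum_(j <- t) V j in
  r ^+ 2 / 4 <= dotv g g <= 4 * r ^+ 2 ->
  n%:R * r ^+ 2 / 32 <= \sum_(i < n) clipsq tau (dotv (x i) g).
Hypothesis budget : (S + 4 * n%:R * kappa ^+ 2 * Delta ^+ 2) / k%:R <=
  n%:R * r ^+ 2 / 768.

Lemma quadratic_lower_bound (h : 'rV[R]_p) : h = \sum_j c j *: V j ->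
  dotv h h = r ^+ 2 -> n%:R * r ^+ 2 / 128 <= \sum_(i < n) dotv (x i) h ^+ 2.
Proof.
move=> hE hr; have nR0 : 0 < n%:R :> R by rewrite ltr0n.
have kR0 : 0 < k%:R :> R by rewrite ltr0n.
have r20 : 0 < r ^+ 2 by rewrite exprn_gt0.
have kg := kappa_ge.
have k16 : 1 <= 16 * kappa ^+ 2.
  have : 0 <= (4 * kappa - 1) * (4 * kappa + 1) by rewrite mulr_ge0//; lra.
  lra.
(* With this weight the Euclidean part costs [n (2 kappa Delta)^2], comparable to the leading part
   of the Huber bound; as [16 kappa^2 >= 1], the weight is still at least [n / 4]. *)
have g0 : 0 <= 4 * n%:R * kappa ^+ 2 by rewrite mulr_ge0 ?sqr_ge0// mulr_ge0.
have [t /=] := maurey_clipsq kp t0 g0 c0 c1 huber VD.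
rewrite -hE; set g := k%:R^-1 *: _; set e := g - h => -[e1 e2].
have {e1} ee : dotv e e <= r ^+ 2 / 192.
  have ee0 := dotvv_ge0 e.
  have : n%:R * dotv e e <= n%:R * (4 * (r ^+ 2 / 768)).
    have : n%:R * dotv e e * 1 <= n%:R * dotv e e * (16 * kappa ^+ 2).
      by rewrite ler_wpM2l// mulr_ge0// ltW.
    have := le_trans e1 budget; lra.
  by rewrite ler_pM2l//; lra.
have gh : g = h + e by rewrite /e addrC subrK.
have hg : h = g - e by rewrite gh addrK.
have ghi : dotv g g <= 4 * r ^+ 2.
  by rewrite gh; apply: le_trans (dotvvD_le _ _) _; rewrite hr; lra.
have glo : r ^+ 2 / 4 <= dotv g g.
  have : dotv h h <= 2 * dotv g g + 2 * dotv e e.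
    rewrite [in X in X <= _]hg; apply: le_trans (dotvvD_le _ _) _.
    by rewrite dotvNr dotvC dotvNr opprK.
  by rewrite hr; lra.
have gnet : n%:R * r ^+ 2 / 32 <= \sum_(i < n) clipsq tau (dotv (x i) g).
  by apply: (net (t := t)); apply/andP.
have {e2} ce : \sum_(i < n) clipsq tau (dotv (x i) e) <= n%:R * r ^+ 2 / 128.
  have kge : 0 <= 4 * n%:R * kappa ^+ 2 * Delta ^+ 2 / k%:R.
    by rewrite divr_ge0// mulr_ge0 ?sqr_ge0.
  have b1 : (6 * S + 2 * (4 * n%:R * kappa ^+ 2) * Delta ^+ 2) / k%:R <=
      n%:R * r ^+ 2 / 128.
    have E1 : (6 * S + 2 * (4 * n%:R * kappa ^+ 2) * Delta ^+ 2) / k%:R =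
      6 * ((S + 4 * n%:R * kappa ^+ 2 * Delta ^+ 2) / k%:R) -
      4 * (4 * n%:R * kappa ^+ 2 * Delta ^+ 2 / k%:R) by ring.
    by have bg := budget; rewrite E1; lra.
  apply: le_trans b1; apply: le_trans e2.
  rewrite le_eqVlt; apply/orP; left; apply/eqP; apply: eq_bigr => i _.
  congr clipsq; rewrite /e dotvBr /g dotvZr dotv_sumr hE dotv_sumr.
  by congr (_ - _); apply: eq_bigr => j _; rewrite dotvZr.
(* In units of [n r^2]: the net gives [1/32], twice the sampling error takes away [2/128], and
   halving leaves [1/128]. *)
have split_g : \sum_(i < n) clipsq tau (dotv (x i) g) <=
    2 * \sum_(i < n) dotv (x i) h ^+ 2 + 2 * \sum_(i < n) clipsq tau (dotv (x i) e).
  rewrite !mulr_sumr -big_split/=; apply: ler_sum => i _.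
  rewrite gh dotvDr; apply: le_trans (clipsqD_le _ _ _) _.
  by rewrite lerD2r ler_pM2l// clipsq_le_sqr.
lra.
Qed.

End Deterministic.

(** * Localization of the empirical minimizer *)

Section Localization.
Context {R : realType} {p n : nat}.
Variables (z : 'I_n -> Rvec R p * R) (K : set 'rV[R]_p) (b bhat : 'rV[R]_p).
Variables (r U : R).
Hypotheses (n0 : (0 < n)%N) (r0 : 0 < r) (cK : convexK K) (Kb : K b).
Hypothesis bhat_min : minimizer_on K (empirical_risk z) bhat.
Hypothesis lower : forall v, K v -> dotv (v - b) (v - b) = r ^+ 2 ->
  n%:R * r ^+ 2 / 128 <= \sum_(i < n) dotv (z i).1 (v - b) ^+ 2.
Hypothesis upper : forall v, K v ->
  \sum_(i < n) residual (z i) b * dotv (z i).1 (v - b) <= U.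
Hypothesis gap : 256 * U < n%:R * r ^+ 2.

(* Star-shapedness: if the error exceeds [r], shrink it towards [b] to length
   exactly [r]; the basic inequality survives the shrinking. *)
Lemma localization : l2norm (bhat - b) <= r.
Proof.
rewrite leNgt; apply/negP => rh.
have [Kbh bmin] := bhat_min; have gp := gap.
set h := bhat - b in rh; have h0 : 0 < l2norm h by exact: lt_trans rh.
pose t := r / l2norm h.
have t0 : 0 < t by rewrite divr_gt0.
have t1 : t <= 1 by rewrite ler_pdivrMr// mul1r ltW.
pose v := t *: bhat + (1 - t) *: b.
have Kv : K v by apply: cK => //; rewrite (ltW t0).
have vE : v - b = t *: h.
  by rewrite /v scalerBl scale1r scalerBr addrA addrAC addrK.
have vr : dotv (v - b) (v - b) = r ^+ 2.
  by rewrite vE -sqr_l2norm l2normZ ?(ltW t0)// /t divfK// gt_eqF.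
have nR0 : 0 < n%:R :> R by rewrite ltr0n.
have basic : \sum_(i < n) dotv (z i).1 h ^+ 2 <=
    2 * \sum_(i < n) residual (z i) b * dotv (z i).1 h.
  have := bmin _ Kb; rewrite /empirical_risk ler_pM2l ?invr_gt0//.
  rewrite -subr_ge0 -sumrB (eq_bigr (fun i =>
      2 * (residual (z i) b * dotv (z i).1 h) - dotv (z i).1 h ^+ 2)).
    by rewrite sumrB -mulr_sumr subr_ge0.
  by move=> i _; rewrite /residual /h dotvBr; ring.
have lo := lower Kv vr; have up := upper Kv.
have vh i : dotv (z i).1 (v - b) = t * dotv (z i).1 h by rewrite vE dotvZr.
have lo' : n%:R * r ^+ 2 / 128 <= t ^+ 2 * \sum_(i < n) dotv (z i).1 h ^+ 2.
  apply: le_trans lo _; rewrite mulr_sumr le_eqVlt; apply/orP; left; apply/eqP.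
  by apply: eq_bigr => i _; rewrite vh exprMn.
have up' : t * (\sum_(i < n) residual (z i) b * dotv (z i).1 h) <= U.
  apply: le_trans up; rewrite mulr_sumr le_eqVlt; apply/orP; left; apply/eqP.
  by apply: eq_bigr => i _; rewrite vh; ring.
have := ler_wpM2l (sqr_ge0 t) basic => basic'.
set Q := \sum_(i < n) residual _ _ * _ in basic basic' up'.
have nr0 : 0 < n%:R * r ^+ 2 by rewrite mulr_gt0// exprn_gt0.
(* The lower bound and the basic inequality give [n r^2 / 128 <= 2 t^2 Q]; so [t Q > 0], whence
   [t^2 Q <= t Q <= U], against [gap]. *)
have tQ0 : 0 < t * Q.
  rewrite -(pmulr_rgt0 _ t0); lra.
have : t * (t * Q) <= 1 * (t * Q) by rewrite ler_wpM2r// ltW.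
lra.
Qed.

End Localization.

(* [N] is [sqrt n], [m] is [max(1, u^2 sigma)] and [r] is the claimed error
   bound; [2 ^+ 22] is the square root of [C1] and [2 ^+ 100] the square of
   [C2].  The conditions only involve [C1] and [C2] through lower bounds, so
   their values are generous. *)
Section SampleSize.
Context {R : realType}.
Variables (kappa Delta L N m u r : R).

(** The summands of the sample-size assumption serve separately: [u >= 8] gives the first
    conclusion, [sqrt L >= 1/2] the next two, and the summand with [L / N] the last. *)
Lemma sample_size_bounds : 4^-1 <= kappa -> 0 < Delta -> 2^-1 <= L -> 1 <= N ->
  1 <= m -> 8 <= u ->
  2 ^+ 22 * (kappa ^+ 10 * Delta * (L / N + Num.sqrt L) + kappa ^+ 6 * u) <= N ->
  0 < r ->
  r ^+ 2 * N = 2 ^+ 100 * kappa ^+ 37 * m ^+ 2 * Delta * L ->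
  [/\ 64 * 1600 * 16 * kappa ^+ 6 <= N,
    2 * (68 * 1536) * (64 * 1600) * (kappa ^+ 6 * Delta ^+ 2 * L)
      <= N ^+ 2 * r ^+ 2,
    160 * 3072 * (kappa ^+ 3 * Delta) <= N * r &
    160 * 3072 * (kappa ^+ 3 * Delta * L) <= N ^+ 2 * r].
Proof.
move=> kg D0 Lg N1 m1 u8 G r0 rN.
have k0 : 0 < kappa by lra.
have N0 : 0 < N by lra.
have L0 : 0 < L by lra.
have kk j : 0 < kappa ^+ j by rewrite exprn_gt0.
have kk4 j : 1 <= (4 * kappa) ^+ j by apply: exprn_ege1; lra.
have sL : 2^-1 <= Num.sqrt L.
  rewrite -(ler_pXn2r (n := 2)) ?nnegrE ?sqrtr_ge0//.
  by rewrite sqr_sqrtr ?(ltW L0)//; lra.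
(* [W] is what remains of [r^2 N] after splitting off [kappa^6 m^2 Delta L]. With the [kappa^10] of
   the assumption it forms [kappa^41], compensated by [2^82 = 4^41]. *)
pose W := 2 ^+ 100 * kappa ^+ 31.
have W0 : 0 < W by rewrite mulr_gt0// exprn_gt0.
have W1 : 1 <= 2 ^+ 82 * kappa ^+ 41.
  by have := kk4 41; rewrite exprMn (_ : 4 = 2 ^+ 2) -?exprM//; ring.
have WE : 2 ^+ 22 * kappa ^+ 10 * W = 2 ^+ 40 * (2 ^+ 82 * kappa ^+ 41).
  by rewrite /W; ring.
have KD0 : 0 < kappa ^+ 10 * Delta by rewrite mulr_gt0.
have G1 : 2 ^+ 22 * kappa ^+ 10 * (Delta / 2) <= N.
  apply: le_trans G; have : 0 <= L / N by rewrite divr_ge0// ltW.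
  have : kappa ^+ 10 * Delta * 2^-1 <= kappa ^+ 10 * Delta * Num.sqrt L.
    by rewrite ler_pM2l.
  have : 0 <= kappa ^+ 6 * u by rewrite mulr_ge0 ?(ltW (kk 6))//; lra.
  move=> h1 h2 h3.
  have : 0 <= kappa ^+ 10 * Delta * (L / N) by rewrite mulr_ge0// ltW.
  rewrite (_ : 2 ^+ 22 * kappa ^+ 10 * (Delta / 2) =
    2 ^+ 22 * (kappa ^+ 10 * Delta * 2^-1)); last by field.
  rewrite ler_pM2l ?exprn_gt0//; lra.
have G2 : 2 ^+ 22 * kappa ^+ 10 * (Delta * L) <= N ^+ 2.
  have : 2 ^+ 22 * (kappa ^+ 10 * Delta * (L / N)) <= N.
    apply: le_trans G; rewrite ler_pM2l ?exprn_gt0//.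
    have : 0 <= kappa ^+ 10 * Delta * Num.sqrt L by rewrite mulr_ge0 ?sqrtr_ge0// ltW.
    have : 0 <= kappa ^+ 6 * u by rewrite mulr_ge0 ?(ltW (kk 6))//; lra.
    lra.
  rewrite -(ler_pM2l N0) -expr2.
  by rewrite (_ : N * _ = 2 ^+ 22 * kappa ^+ 10 * (Delta * L))//; field; rewrite gt_eqF.
have G3 : 2 ^+ 25 * kappa ^+ 6 <= N.
  apply: le_trans G.
  have h : 0 <= kappa ^+ 10 * Delta * (L / N + Num.sqrt L).
    by rewrite mulr_ge0 ?(ltW KD0)// addr_ge0 ?sqrtr_ge0 ?divr_ge0 ?ltW.
  have h' : kappa ^+ 6 * 8 <= kappa ^+ 6 * u by rewrite ler_pM2l.
  rewrite (_ : 2 ^+ 25 * kappa ^+ 6 = 2 ^+ 22 * (kappa ^+ 6 * 8)); last by ring.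
  rewrite ler_pM2l ?exprn_gt0//; lra.
have F2 : 2 ^+ 39 * Delta <= N * W.
  apply: le_trans (ler_wpM2r (ltW W0) G1).
  rewrite (_ : 2 ^+ 22 * kappa ^+ 10 * (Delta / 2) * W =
    2 ^+ 39 * Delta * (2 ^+ 82 * kappa ^+ 41)); last by rewrite /W; field.
  by rewrite ler_peMr// mulr_ge0// ?(ltW D0)// exprn_ge0.
have F1 : 2 ^+ 38 * Delta <= N * W * L.
  apply: (@le_trans _ _ (2 ^+ 39 * Delta * 2^-1)).
    rewrite (_ : 2 ^+ 39 * Delta * 2^-1 = 2 ^+ 38 * Delta)//; by field.
  by apply: ler_pM => //; rewrite ?mulr_ge0 ?exprn_ge0 ?(ltW D0).
have F3 : 2 ^+ 40 * (Delta * L) <= N ^+ 3 * W.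
  have h : 2 ^+ 40 * (Delta * L) <= N ^+ 2 * W.
    apply: le_trans (ler_wpM2r (ltW W0) G2).
    rewrite (_ : 2 ^+ 22 * kappa ^+ 10 * (Delta * L) * W =
      2 ^+ 40 * (Delta * L) * (2 ^+ 82 * kappa ^+ 41)); last by rewrite /W; ring.
    by rewrite ler_peMr// mulr_ge0 ?exprn_ge0// mulr_ge0// ltW.
  apply: le_trans h _.
  by rewrite ler_pM2r// [leRHS]exprSr ler_peMr// exprn_ge0// ltW.
have RN : W * kappa ^+ 6 * Delta * L <= r ^+ 2 * N.
  rewrite rN (_ : 2 ^+ 100 * kappa ^+ 37 * m ^+ 2 * Delta * L =
    W * kappa ^+ 6 * Delta * L * m ^+ 2); last by rewrite /W; ring.
  apply: ler_peMr; last exact: exprn_ege1.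
  by apply/ltW; apply: mulr_gt0 L0; apply: mulr_gt0 D0; apply: mulr_gt0 W0 (kk 6).
have r20 : 0 < r ^+ 2 by rewrite exprn_gt0.
have A1 : 2 ^+ 39 * (kappa ^+ 6 * Delta ^+ 2 * L) <= N ^+ 2 * r ^+ 2.
  apply: (@le_trans _ _ (N * (W * kappa ^+ 6 * Delta * L))); last first.
    by rewrite (_ : N ^+ 2 * r ^+ 2 = N * (r ^+ 2 * N)) ?ler_pM2l//; ring.
  have p0 : 0 <= kappa ^+ 6 * Delta * L by rewrite ltW// !mulr_gt0.
  have := ler_wpM2r p0 F2; lra.
have A2 : (2 ^+ 19 * (kappa ^+ 3 * Delta)) <= N * r.
  rewrite -(ler_pXn2r (n := 2)) ?nnegrE//; last first.
  - by rewrite mulr_ge0 ?ltW.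
  - by rewrite mulr_ge0 ?exprn_ge0// mulr_ge0 ?(ltW (kk 3)) ?ltW.
  apply: (@le_trans _ _ (N * (W * kappa ^+ 6 * Delta * L))); last first.
    by rewrite (_ : (N * r) ^+ 2 = N * (r ^+ 2 * N)) ?ler_pM2l//; ring.
  have p0 : 0 <= kappa ^+ 6 * Delta by rewrite ltW// !mulr_gt0.
  have := ler_wpM2r p0 F1; lra.
have A3 : (2 ^+ 19 * (kappa ^+ 3 * Delta * L)) <= N ^+ 2 * r.
  rewrite -(ler_pXn2r (n := 2)) ?nnegrE//; last first.
  - by rewrite mulr_ge0 ?(ltW r0)// exprn_ge0// ltW.
  - by rewrite mulr_ge0 ?exprn_ge0// !mulr_ge0 ?(ltW (kk 3)) ?ltW.
  apply: (@le_trans _ _ (N ^+ 3 * (W * kappa ^+ 6 * Delta * L))); last first.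
    rewrite (_ : (N ^+ 2 * r) ^+ 2 = N ^+ 3 * (r ^+ 2 * N)); last by ring.
    by rewrite ler_pM2l ?exprn_gt0.
  have p0 : 0 <= kappa ^+ 6 * (Delta * L) by rewrite ltW// !mulr_gt0.
  have p1 : 0 <= kappa ^+ 6 * (Delta * L) * (Delta * L) by rewrite !mulr_ge0 ?ltW.
  have := ler_wpM2r p0 F3; lra.
clear WE G1 G2 F1 F2 F3 W1 W0 RN G sL rN.
have d3 : 0 < kappa ^+ 3 * Delta by rewrite mulr_gt0.
split.
- apply: le_trans G3; rewrite ler_pM2r//; lra.
- apply: le_trans A1; rewrite ler_pM2r ?mulr_gt0 ?exprn_gt0//; lra.
- apply: le_trans A2; rewrite ler_pM2r//; lra.
- apply: le_trans A3; rewrite ler_pM2r ?mulr_gt0//; lra.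
Qed.

(** [X] is the least real sampling size that keeps the part decaying like [1 / k] within half of the
    budget. In the part linear in [k] the division cancels [k]; it splits into an [L] and an [N]
    term, with a quarter of the budget each. *)
Lemma sample_size_budget : 4^-1 <= kappa -> 0 < Delta -> 0 < L -> 0 < N ->
  0 < r -> r < Delta ->
  64 * 1600 * 16 * kappa ^+ 6 <= N ->
  2 * (68 * 1536) * (64 * 1600) * (kappa ^+ 6 * Delta ^+ 2 * L)
    <= N ^+ 2 * r ^+ 2 ->
  160 * 3072 * (kappa ^+ 3 * Delta) <= N * r ->
  160 * 3072 * (kappa ^+ 3 * Delta * L) <= N ^+ 2 * r ->
  exists k : nat, [/\ (0 < k)%N,
    (16 * N ^+ 2 * (2 * kappa * Delta) ^+ 2 +
       2 * (k%:R * (40 * kappa ^+ 2 * r)) * (2 * kappa * Delta) * (L + N) +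
       4 * N ^+ 2 * kappa ^+ 2 * Delta ^+ 2) / k%:R <= N ^+ 2 * r ^+ 2 / 768 &
    k%:R * L + N <= N ^+ 2 * r ^+ 2 / (32 * (40 * kappa ^+ 2 * r) ^+ 2)].
Proof.
move=> kg D0 L0 N0 r0 rD.
have k0 : 0 < kappa by lra.
have kk j : 0 < kappa ^+ j by rewrite exprn_gt0.
have kk4 j : 1 <= (4 * kappa) ^+ j by apply: exprn_ege1; lra.
have r20 : 0 < r ^+ 2 by rewrite exprn_gt0.
have k16 : 1 <= 16 * kappa ^+ 2 by have := kk4 2; lra.
(* [68 = 16 * 4 + 4] collects the two terms in [N^2 kappa^2 Delta^2], and [1536] is twice [768]. *)
pose X := 68 * 1536 * kappa ^+ 2 * Delta ^+ 2 / r ^+ 2.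
(* A consequence of [r < Delta]; it bounds the rounded value by [2 * X]. *)
have X1 : 1 <= X.
  rewrite ler_pdivlMr// mul1r.
  have rD2 : r ^+ 2 <= Delta ^+ 2 by rewrite ler_pXn2r ?nnegrE ?ltW.
  have D20 : 0 <= Delta ^+ 2 by rewrite sqr_ge0.
  have := ler_wpM2r D20 k16; lra.
have [k Xk kX] : exists2 k : nat, X <= k%:R & k%:R <= 2 * X.
  exists (Num.truncn X).+1.
    by rewrite ltW// truncnS_gt.
  have X0 : 0 <= X by lra.
  have /andP[] := truncn_itv X0; rewrite -natr1; lra.
have kR1 : 1 <= k%:R :> R by lra.
have kR0 : 0 < k%:R :> R by lra.
move=> G3 A1 A2 A3; exists k; split; first by rewrite -(ltr0n R).
- clear G3 A1; have Xr : 68 * 1536 * kappa ^+ 2 * Delta ^+ 2 <= r ^+ 2 * k%:R.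
    by rewrite [leRHS]mulrC -ler_pdivrMr.
  have E : (16 * N ^+ 2 * (2 * kappa * Delta) ^+ 2 +
       2 * (k%:R * (40 * kappa ^+ 2 * r)) * (2 * kappa * Delta) * (L + N) +
       4 * N ^+ 2 * kappa ^+ 2 * Delta ^+ 2) / k%:R =
     68 * N ^+ 2 * kappa ^+ 2 * Delta ^+ 2 / k%:R +
     160 * r * (kappa ^+ 3 * Delta * L) + 160 * r * (kappa ^+ 3 * Delta * N).
    by field; rewrite gt_eqF.
  rewrite E.
  have e1 : 68 * N ^+ 2 * kappa ^+ 2 * Delta ^+ 2 / k%:R <=
      N ^+ 2 * r ^+ 2 / 1536.
    rewrite ler_pdivrMr//; clear A2 A3.
    have := ler_wpM2l (sqr_ge0 N) Xr; clear Xr; lra.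
  have e2 : 160 * r * (kappa ^+ 3 * Delta * L) <= N ^+ 2 * r ^+ 2 / 3072.
    clear e1; have := ler_wpM2l (ltW r0) A3; clear Xr A2 A3.
    have : 0 <= r * (kappa ^+ 3 * Delta * L) by rewrite ltW// !mulr_gt0.
    lra.
  have e3 : 160 * r * (kappa ^+ 3 * Delta * N) <= N ^+ 2 * r ^+ 2 / 3072.
    have rN0 : 0 <= r * N by rewrite mulr_ge0 ?ltW.
    clear e1 e2; have := ler_wpM2l rN0 A2; clear Xr A2 A3.
    have : 0 <= r * N * (kappa ^+ 3 * Delta) by rewrite ltW// !mulr_gt0.
    lra.
  clear Xr A2 A3; lra.
- clear A2 A3; have -> : N ^+ 2 * r ^+ 2 / (32 * (40 * kappa ^+ 2 * r) ^+ 2) =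
      N ^+ 2 / (32 * 1600 * kappa ^+ 4) by field; rewrite !gt_eqF.
  have c0 : 0 < 32 * 1600 * kappa ^+ 4.
    by apply: mulr_gt0 (kk 4); apply: mulr_gt0; rewrite ltr0n.
  rewrite (ler_pdivlMr _ _ c0); clear c0.
  have b1 : N * (64 * 1600 * kappa ^+ 4) <= N ^+ 2.
    rewrite expr2 ler_pM2l//; apply: le_trans G3; clear A1.
    have := ler_wpM2r (ltW (kk 4)) k16; lra.
  clear G3; have b2 : k%:R * L * (64 * 1600 * kappa ^+ 4) <= N ^+ 2.
    have h0 : 0 <= L * (64 * 1600 * kappa ^+ 4).
      apply: mulr_ge0 (ltW L0) _; apply: mulr_ge0 (ltW (kk 4)).
      by apply: mulr_ge0; rewrite ler0n.
    rewrite -mulrA; apply: le_trans (ler_wpM2r h0 kX) _; clear h0.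
    rewrite /X (_ : 2 * _ * _ =
      (2 * (68 * 1536) * (64 * 1600)) * (kappa ^+ 6 * Delta ^+ 2 * L) / r ^+ 2); last first.
      by field; rewrite gt_eqF.
    by rewrite (ler_pdivrMr _ _ r20); exact: A1.
  clear A1; lra.
Qed.

(** The noise level is linear in [m] and [kappa]; the spare factors [m] and [(4 kappa)^36] on the
    right are at least one. *)
Lemma sample_size_gap : 4^-1 <= kappa -> 0 < Delta -> 0 < L -> 0 < N -> 1 <= m ->
  r ^+ 2 * N = 2 ^+ 100 * kappa ^+ 37 * m ^+ 2 * Delta * L ->
  256 * (32 * m * (2 * kappa * Delta) * N * L) < N ^+ 2 * r ^+ 2.
Proof.
move=> kg D0 L0 N0 m1 rN.
have k36 : 1 <= (4 * kappa) ^+ 36 by apply: exprn_ege1; lra.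
have -> : N ^+ 2 * r ^+ 2 = N * (r ^+ 2 * N) by ring.
rewrite rN.
have -> : N * (2 ^+ 100 * kappa ^+ 37 * m ^+ 2 * Delta * L) =
    2 ^+ 28 * (m * kappa * Delta * N * L) * (m * (4 * kappa) ^+ 36) by ring.
have p0 : 0 < m * kappa * Delta * N * L by rewrite !mulr_gt0//; lra.
have : 1 <= m * (4 * kappa) ^+ 36 by rewrite mulr_ege1.
move=> h; have := ler_wpM2l (ltW p0) h; lra.
Qed.

End SampleSize.

(** * Assembling the events and their failure probabilities *)

Section Combination.
Context {R : realType} {p n D : nat} {d0 d : measure_display}
  {T0 : measurableType d0} {T : measurableType d}.
Variables (P0 : probability T0 R) (P : probability T R).
Variables (xy : {RV P0 >-> (Rvec R p * R)%type})
  (XY : 'I_n -> {RV P >-> (Rvec R p * R)%type}).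
Variables (K : set 'rV[R]_p) (b : 'rV[R]_p) (V : 'I_D -> 'rV[R]_p).
Variables (kappa Delta s L N r u m : R).

(** The multiplier term is absorbed thanks to [u >= 8] and [L >= 1/2]. With [E = exp (- N / 4)] the
    rest is [4 E^12 + 2 E^4], at most [2 E] because [N >= 1] gives [E <= 4/5]. *)
Lemma failure_probability_le : 1 <= N -> 2^-1 <= L -> 8 <= u ->
  4 * expR (- (3 * N)) + expR (L + 3 - u ^+ 2 * L) + (expR (- N) + expR (- N)) <=
  5 * expR (- (4^-1 * u ^+ 2)) + 2 * expR (- (4^-1 * N)).
Proof.
move=> N1 Lg u8.
have h1 : expR (L + 3 - u ^+ 2 * L) <= expR (- (4^-1 * u ^+ 2)).
  rewrite ler_expR; have u64 : 64 <= u ^+ 2.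
    have : 0 <= (u - 8) * (u + 8) by rewrite mulr_ge0//; lra.
    lra.
  have : 0 <= (u ^+ 2 - 64) * (L - 4^-1) by rewrite mulr_ge0//; lra.
  lra.
have e0 := expR_ge0 (- (4^-1 * u ^+ 2)).
set E := expR (- (4^-1 * N)).
have E0 : 0 <= E := expR_ge0 _.
have E1 : E <= 4 / 5.
  rewrite /E expRN -[leLHS]mul1r ler_pdivrMr ?expR_gt0//.
  have := expR_ge1Dx (4^-1 * N); lra.
have -> : expR (- N) = E ^+ 4 by rewrite /E -expRM_natl; congr expR; field.
have -> : expR (- (3 * N)) = E ^+ 12 by rewrite /E -expRM_natl; congr expR; field.
have E3 : E ^+ 3 <= (4 / 5) ^+ 3 by rewrite lerXn2r ?nnegrE//; lra.
have E11 : E ^+ 11 <= (4 / 5) ^+ 11 by rewrite lerXn2r ?nnegrE//; lra.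
have := ler_wpM2l E0 E3; have := ler_wpM2l E0 E11.
rewrite -!exprS => h2 h3.
have n3 : (4 / 5) ^+ 3 <= 3 / 5 :> R by lra.
have n11 : (4 / 5) ^+ 11 <= 1 / 5 :> R by lra.
have := ler_wpM2l E0 n3; have := ler_wpM2l E0 n11; lra.
Qed.

Lemma error_le_radius : independent_copies xy XY ->
  isotropic P0 (fun w => (xy w).1) ->
  (psi1_norm_vec P0 (fun w => (xy w).1) <= kappa%:E)%E ->
  convexK K -> minimizer_on K (risk P0 xy) b ->
  (forall j, K (V j + b)) -> (forall j, l2norm (V j) <= Delta) ->
  (forall v, K v -> exists c : 'I_D -> R,
     [/\ forall j, 0 <= c j, \sum_j c j = 1 & v - b = \sum_j c j *: V j]) ->
  (\int[P0]_w (expR (`|residual (xy w) b| / s))%:E <= 2%:E)%E ->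
  u ^+ 2 * s = 2 * m ->
  D%:R <= expR L -> n%:R = N ^+ 2 -> 1 <= N -> 2^-1 <= L -> 8 <= u ->
  4^-1 <= kappa -> 0 < Delta -> 1 <= m -> 0 < r -> r < Delta ->
  2 ^+ 22 * (kappa ^+ 10 * Delta * (L / N + Num.sqrt L) + kappa ^+ 6 * u) <= N ->
  r ^+ 2 * N = 2 ^+ 100 * kappa ^+ 37 * m ^+ 2 * Delta * L ->
  holds_with_prob_ge P
    (1 - (4 * expR (- (3 * N)) + expR (L + 3 - u ^+ 2 * L) +
       (expR (- N) + expR (- N))))
    [set w | forall bhat, minimizer_on K (empirical_risk (fun i => XY i w)) bhat ->
      l2norm (bhat - b) <= r].
Proof.
move=> indep iso xk cK bmin VK VD KV xi2 us DL nN N1 Lg u8 kg D0 m1 r0 rD G rN.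
have N0 : 0 < N by lra.
have L0 : 0 < L by lra.
have k0 : 0 < kappa by lra.
have s0 : 0 < s by rewrite -(pmulr_rgt0 s (exprn_gt0 2 (_ : 0 < u))); lra.
have n0 : (0 < n)%N by rewrite -(ltr0n R) nN exprn_gt0.
have gap := sample_size_gap kg D0 L0 N0 m1 rN.
have [c1 c2 c3 c4] := sample_size_bounds kg D0 Lg N1 m1 u8 G r0 rN.
have [k [kp budget small]] := sample_size_budget kg D0 L0 N0 r0 rD c1 c2 c3 c4.
clear c1 c2 c3 c4 G rN.
(* [40^2 = 1600] exceeds the [1536] required by [net_lower_bound]. *)
pose tau := 40 * kappa ^+ 2 * r.
have tau0 : 0 < tau by rewrite !mulr_gt0// exprn_gt0.
have kt0 : 0 < k%:R * tau by rewrite mulr_gt0// ltr0n.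
have taur : 1536 * kappa ^+ 4 * r ^+ 2 <= tau ^+ 2.
  have : 0 <= kappa ^+ 4 * r ^+ 2 by rewrite ltW// mulr_gt0 ?exprn_gt0.
  rewrite /tau; clear budget small gap; lra.
have cross j : exists2 mu, has_mean P0
    (fun w => residual (xy w) b * dotv (xy w).1 (V j)) mu & mu <= 0.
  by have := cross_moment_le0 cK bmin (VK j) s0 xi2 iso; rewrite addrK.
have E1 := residuals_bounded indep s0 N1 nN xi2.
have E2 := multiplier_bounded indep k0 D0 s0 N1 nN DL xk xi2 VD (u ^+ 2 * L) cross.
have E3 := @huber_bounded _ _ _ _ _ _ _ _ P0 P xy XY indep V kappa Delta L N
  k0 D0 DL xk VD _ kt0.
have small' : k%:R * L + N <= n%:R * r ^+ 2 / (32 * tau ^+ 2) by rewrite nN.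
have E4 := net_lower_bound indep V k0 DL iso xk kp r0 tau0 taur small'.
have := holds_with_prob_geI (holds_with_prob_geI E1 E2) (holds_with_prob_geI E3 E4).
apply: holds_with_prob_ge_sub => // w [[/= w1 w2] [/= w3 w4]] bhat bhat_min.
(* Since [u^2 s = 2 m], the deviation level [u^2 L] of the multiplier sums is expressed through [m];
   this is the origin of [u^2 sigma] in the rate. *)
pose U := 32 * m * (2 * kappa * Delta) * N * L.
have UE : 16 * s * (2 * kappa * Delta) * N * (u ^+ 2 * L) = U.
  rewrite (_ : _ * (u ^+ 2 * L) =
    16 * (u ^+ 2 * s) * (2 * kappa * Delta) * N * L); last by ring.
  by rewrite us /U; ring.
apply: (localization n0 r0 cK bmin.1 bhat_min (U := U)).
- move=> v Kv vr; have [c [c0 c1 vE]] := KV v Kv.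
  apply: (quadratic_lower_bound n0 kp tau0 r0 kg c0 c1 _ w3 _ _ vE vr).
  + by move=> j; rewrite -sqr_l2norm ler_pXn2r ?nnegrE ?l2norm_ge0// ltW.
  + exact: w4.
  + by rewrite nN; exact: budget.
- move=> v Kv; have [c [c0 c1 vE]] := KV v Kv.
  have -> : \sum_(i < n) residual (XY i w) b * dotv (XY i w).1 (v - b) =
      \sum_j c j * \sum_(i < n) residual (XY i w) b * dotv (XY i w).1 (V j).
    under [RHS]eq_bigr do rewrite mulr_sumr.
    rewrite exchange_big/=; apply: eq_bigr => i _.
    rewrite vE dotv_sumr mulr_sumr; apply: eq_bigr => j _.
    by rewrite dotvZr mulrCA.
  rewrite -[leRHS]mul1r -[X in _ <= X * _]c1 mulr_suml.
  apply: ler_sum => j _; rewrite ler_wpM2l// -UE; apply: le_trans (w2 j).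
  rewrite le_eqVlt; apply/orP; left; apply/eqP; apply: eq_bigr => i _.
  by rewrite w1.
- by rewrite nN.
Qed.

End Combination.

(** * Indexing by vertices and the final case analysis *)

Lemma hull_weights (R : realType) (p : nat) (s : seq 'rV[R]_p) (b v : 'rV[R]_p) :
  hull s v -> exists c : 'I_(size s) -> R,
    [/\ forall j, 0 <= c j, \sum_j c j = 1 & v - b = \sum_j c j *: (s`_j - b)].
Proof.
move=> [c [c0 c1 cv]]; exists (fun j => c s`_j); split=> //.
- by rewrite -c1 (big_nth 0) big_mkord.
- under eq_bigr do rewrite scalerBr.
  rewrite sumrB -scaler_suml; congr (_ - _).
    by rewrite -cv (big_nth 0) big_mkord.
  by rewrite -(big_mkord xpredT (fun j => c s`_j)) -(big_nth 0 xpredT) c1 scale1r.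
Qed.

Lemma hull_size_gt1 (R : realType) (p : nat) (s : seq 'rV[R]_p) (x y : 'rV[R]_p) :
  hull s x -> hull s y -> x != y -> (1 < size s)%N.
Proof.
case: s => [|a [|//]] [c [_ c1 cx]] [e [_ e1 ey]].
  by move: c1; rewrite big_nil => /eqP; rewrite eq_sym oner_eq0.
rewrite !big_seq1 in c1 cx e1 ey.
by rewrite -cx -ey c1 e1 eqxx.
Qed.

Lemma ln_ge_half (R : realType) (D : nat) : (1 < D)%N -> 2^-1 <= ln D%:R :> R.
Proof.
move=> D2; have D0 : 0 < D%:R :> R by rewrite ltr0n ltnW.
rewrite -ler_expR lnK ?posrE//; apply: (@le_trans _ _ 2); last by rewrite ler_nat.
have := expR_ge1Dx (- 2^-1 : R); rewrite expRN => h.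
rewrite -(ler_pM2l (_ : 0 < (expR 2^-1)^-1)) ?invr_gt0 ?expR_gt0//.
rewrite mulVf ?gt_eqF ?expR_gt0//; lra.
Qed.

Theorem proposition1p4 (R : realType) :
  exists C C1 C2 : R, [/\ 0 < C, 0 < C1 & 0 < C2] /\
  forall (p : nat)
    (d0 : measure_display) (T0 : measurableType d0) (P0 : probability T0 R)
    (xy : {RV P0 >-> (Rvec R p * R)%type}) (kappa : R)
    (K : set 'rV[R]_p) (D : nat) (betastar : 'rV[R]_p)
    (n : nat)
    (d : measure_display) (T : measurableType d) (P : probability T R)
    (XY : 'I_n -> {RV P >-> (Rvec R p * R)%type}) (u : R),
  (psi1_norm P0 (fun w => (xy w).2) < +oo)%E ->
  isotropic P0 (fun w => (xy w).1) ->
  0 < kappa ->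
  (psi1_norm_vec P0 (fun w => (xy w).1) <= kappa%:E)%E ->
  convex_polytope K ->
  (vertices K #= `I_D)%card ->
  minimizer_on K (risk P0 xy) betastar ->
  (0 < n)%N ->
  independent_copies xy XY ->
  8 <= u ->
  holds_with_prob_ge P
    (1 - 5 * expR (- (C * u ^+ 2)) - 2 * expR (- (C * Num.sqrt n%:R)))
    [set w |
      C1 * (kappa ^+ 10 * diam2 K
              * (ln D%:R / Num.sqrt n%:R + Num.sqrt (ln D%:R))
            + kappa ^+ 6 * u) ^+ 2 <= n%:R ->
      forall betahat : 'rV[R]_p,
        minimizer_on K (empirical_risk (fun i => XY i w)) betahat ->
        ((l2norm (betahat - betastar))%:E <=
          (C2 * kappa ^+ 18)%:E
          * maxe 1 ((u ^+ 2)%:E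
                    * psi1_norm P0 (fun w0 => residual (xy w0) betastar))
          * (Num.sqrt (kappa * diam2 K * ln D%:R) / n%:R `^ (4^-1))%:E)%E].
Proof.
exists 4^-1, (2 ^+ 44), (2 ^+ 50); split.
  by split; rewrite ?invr_gt0 ?exprn_gt0.
move=> p d0 T0 P0 xy kappa K D b n d T P XY u.
move=> _ iso k0 xk polyK VD bmin n0 indep u8.
set N := Num.sqrt n%:R; set Delta := diam2 K; set L := ln D%:R.
have nR1 : 1 <= n%:R :> R by rewrite ler1n.
have nN : n%:R = N ^+ 2 by rewrite sqr_sqrtr.
have N1 : 1 <= N by rewrite -[X in X <= _]sqrtr1 ler_wsqrtr.
set e := 1 - 5 * _ - 2 * _.
have e1 : e <= 1.
  have := expR_ge0 (- (4^-1 * u ^+ 2)); have := expR_ge0 (- (4^-1 * N)).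
  by rewrite /e; lra.
have cK := polytope_convex polyK.
have [s [us sV Ks]] := polytope_hull polyK.
have sD := uniq_vertices_size VD us sV.
have Kb : K b := bmin.1.
set psi := psi1_norm P0 _.
have rate0 : (0 <= (Num.sqrt (kappa * Delta * L) / n%:R `^ 4^-1)%:E)%E.
  by rewrite lee_fin divr_ge0 ?sqrtr_ge0 ?powR_ge0.
have C2k : 0 < 2 ^+ 50 * kappa ^+ 18 by rewrite mulr_gt0 ?exprn_gt0.
(* Only a second point ensures [Delta > 0] and [log D >= 1/2]; for a single point the error is
   zero. *)
have [single|] := pselect (forall v, K v -> v = b).
  apply: holds_with_prob_geT => // w _ bhat [Kbh _].
  rewrite (single _ Kbh) subrr (_ : l2norm 0 = 0); last first.
    by rewrite /l2norm dotv0r sqrtr0.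
  rewrite !mule_ge0//; first by rewrite lee_fin ltW.
  by rewrite le_max lee01.
move=> /existsNP[v /not_implyP[Kv /eqP vb]].
have v0 : 0 < l2norm (v - b).
  rewrite lt_neqAle l2norm_ge0 andbT eq_sym; apply: contra_neq vb => v0.
  apply/eqP; rewrite -subr_eq0; apply/eqP/dotvv_eq0.
  by rewrite -sqr_l2norm v0 expr0n.
have Delta0 : 0 < Delta by apply: lt_le_trans v0 (l2norm_le_diam2 polyK Kv Kb).
have kg := kappa_lower k0 iso xk v0.
have D1 : (1 < D)%N.
  by apply: leq_trans sD; apply: hull_size_gt1 (Ks _ Kv) (Ks _ Kb) vb.
have Lg : 2^-1 <= L by exact: ln_ge_half.
have L0 : 0 < L by lra.
have rate1 : 0 < Num.sqrt (kappa * Delta * L) / n%:R `^ 4^-1.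
  by rewrite divr_gt0 ?sqrtr_gt0 ?powR_gt0 ?mulr_gt0// ltr0n.
have u20 : 0 < u ^+ 2 by rewrite exprn_gt0//; lra.
have := psi1_norm_ge0 P0 (fun w0 => residual (xy w0) b); rewrite -/psi.
(* An infinite [sigma] makes the right-hand side infinite, the rate being positive. *)
case psiE : psi => [sigma| |] // psi0; last first.
  apply: holds_with_prob_geT => // w _ bhat _.
  rewrite gt0_muley ?lte_fin// (max_idPr _) ?leey// gt0_muley ?lte_fin//.
  by rewrite gt0_mulye ?lte_fin// leey.
pose m := Num.max 1 (u ^+ 2 * sigma).
have m1 : 1 <= m by rewrite le_max lexx.
pose r := 2 ^+ 50 * kappa ^+ 18 * m * (Num.sqrt (kappa * Delta * L) / n%:R `^ 4^-1).
have -> : ((2 ^+ 50 * kappa ^+ 18)%:E * maxe 1 ((u ^+ 2)%:E * sigma%:E) *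
    (Num.sqrt (kappa * Delta * L) / n%:R `^ 4^-1)%:E = r%:E)%E.
  by rewrite -EFinM -EFin_max -!EFinM.
(* The sample-size condition is not random: if it fails, the implication holds everywhere. *)
have [G|nG] := boolP (2 ^+ 44 * (kappa ^+ 10 * Delta * (L / N + Num.sqrt L) +
    kappa ^+ 6 * u) ^+ 2 <= n%:R); last exact: holds_with_prob_geT.
have r0 : 0 < r by rewrite mulr_gt0// mulr_gt0//; lra.
(* A radius of at least the diameter makes the bound trivial; the choice of [k] relies on
   [r < Delta]. *)
have [Dr|rD] := leP Delta r.
  apply: holds_with_prob_geT => // w _ bhat [Kbh _].
  by rewrite lee_fin (le_trans _ Dr)//; exact: l2norm_le_diam2.
have rN : r ^+ 2 * N = 2 ^+ 100 * kappa ^+ 37 * m ^+ 2 * Delta * L.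
  have pN : (n%:R `^ 4^-1) ^+ 2 = N.
    rewrite -powR_mulrn ?powR_ge0// -powRrM /N -powR12_sqrt//.
    by congr (_ `^ _); field.
  have N0 : 0 < N by lra.
  rewrite /r exprMn expr_div_n pN sqr_sqrtr; last by rewrite ltW// !mulr_gt0.
  by field; rewrite gt_eqF.
have sqrtG : 2 ^+ 22 * (kappa ^+ 10 * Delta * (L / N + Num.sqrt L) +
    kappa ^+ 6 * u) <= N.
  rewrite -(ler_pXn2r (n := 2)) ?nnegrE//; last first.
  - by lra.
  - rewrite mulr_ge0 ?exprn_ge0// addr_ge0// mulr_ge0 ?exprn_ge0 ?(ltW k0)//.
    + by rewrite mulr_ge0 ?exprn_ge0 ?(ltW k0) ?(ltW Delta0).
    + by rewrite addr_ge0 ?sqrtr_ge0 ?divr_ge0 ?(ltW L0)//; lra.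
    + by lra.
  by rewrite exprMn -exprM -nN.
(* [u^2 sigma <= m < 2 m] puts [s'] strictly above [sigma], even for [sigma = 0], so it is an
   admissible psi-1 scale. *)
pose s' := 2 * m / u ^+ 2.
have us' : u ^+ 2 * s' = 2 * m by rewrite /s' mulrC divfK// gt_eqF.
have [s'0 xi2] : 0 < s' /\
    (\int[P0]_w (expR (`|residual (xy w) b| / s'))%:E <= 2%:E)%E.
  apply: psi1_norm_lt; first exact: measurable_residual_xy.
  rewrite -/psi psiE lte_fin ltr_pdivlMr// mulrC.
  have : u ^+ 2 * sigma <= m by rewrite le_max lexx orbT.
  lra.
have sizeL : (size s)%:R <= expR L.
  by rewrite lnK ?ler_nat// posrE ltr0n ltnW.
have sK (j : 'I_(size s)) : K s`_j by case: (sV _ (mem_nth 0 (ltn_ord j))).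
have VK (j : 'I_(size s)) : K (s`_j - b + b) by rewrite subrK.
have VDelta (j : 'I_(size s)) : l2norm (s`_j - b) <= Delta.
  exact: l2norm_le_diam2.
have Kc v' (Kv' : K v') := hull_weights b (Ks _ Kv').
have := error_le_radius indep iso xk cK bmin VK VDelta Kc xi2 us' sizeL nN N1 Lg
  u8 kg Delta0 m1 r0 rD sqrtG rN.
apply: holds_with_prob_ge_sub => [|w Hw _ bhat bh].
  by have := failure_probability_le N1 Lg u8; rewrite /e; lra.
by rewrite lee_fin; exact: Hw.
Qed.
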